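(* For every integer $n\ge 3$, $\kappa_{\le 2}\bigl(\mathrm{SL}_n(\mathbb Z)\bigr)=0$; that is, the infimum of the Kazhdan constants $\kappa(\mathrm{SL}_n(\mathbb Z),S)$ over all generating sets $S$ of $\mathrm{SL}_n(\mathbb Z)$ with $|S|\le 2$ is $0$.
   Context: Generating sets are not assumed to be symmetric. For a finitely generated group $\Gamma$ and a finite subset $S\subseteq\Gamma$, the Kazhdan constant relative to $S$ is $$\kappa(\Gamma,S)=\inf_{\pi}\ \inf_{\xi\in\mathcal H,\ \|\xi\|=1}\ \max_{s\in S}\|\pi(s)\xi-\xi\|,$$ where $\pi:\Gamma\to\mathcal U(\mathcal H)$ ranges over all unitary representations of $\Gamma$ on Hilbert spaces $\mathcal H$ with no nonzero invariant vector, i.e. $\mathcal H^\Gamma=\{0\}$. For an integer $d$ at least the minimal number of generators of $\Gamma$, $$\kappa_{\le d}(\Gamma)=\inf\{\kappa(\Gamma,S):\ S\subseteq\Gamma,\ \langle S\rangle=\Gamma,\ |S|\le d\}.$$ *)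

(* Defs.v *)
From HB Require Import structures.
From mathcomp Require Import all_boot all_order all_algebra.
From mathcomp Require Import finmap complex.
From mathcomp Require Import all_classical all_reals all_analysis.

Set Implicit Arguments.
Unset Strict Implicit.
Unset Printing Implicit Defensive.

Import Order.TTheory GRing.Theory Num.Theory.
Import numFieldNormedType.Exports.

Local Open Scope classical_set_scope.
Local Open Scope fset_scope.
Local Open Scope ring_scope.
Local Open Scope complex_scope.

(* The inner product is linear in its first argument and conjugate-linear in  *)
(* its second one.                                                            *)
Record hilbertSpace (R : realType) := HilbertSpace {
  hilbert_sort :> completeNormedModType R[i];
  inner : {dot hilbert_sort for Num.conj};
  inner_normE : forall x : hilbert_sort, inner x x = `|x| ^+ 2
}.

(* The norm of a normed module over R[i] takes its values in R[i].            *)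
Definition hnorm (R : realType) (H : hilbertSpace R) (x : H) : R :=
  complex.Re `|x|.

Definition unitary_op (R : realType) (H : hilbertSpace R)
    (u : {linear H -> H}) : Prop :=
  (forall x y : H, inner H (u x) (u y) = inner H x y) /\ bijective u.

Record unitaryRep (R : realType) (G : groupType) (H : hilbertSpace R) :=
  UnitaryRep {
    rep_fun :> G -> {linear H -> H};
    rep_unitary : forall g, unitary_op (rep_fun g);
    rep1 : forall x, rep_fun 1%g x = x;
    repM : forall g h x, rep_fun (g * h)%g x = rep_fun g (rep_fun h x)
  }.

Definition no_invariant_vector (R : realType) (G : groupType)
    (H : hilbertSpace R) (pi : unitaryRep G H) : Prop :=
  forall x : H, (forall g : G, pi g x = x) -> x = 0.

(* The maximum of the empty family is 0; all the norms are nonnegative.       *)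
Definition max_displacement (R : realType) (G : groupType)
    (H : hilbertSpace R) (pi : unitaryRep G H) (S : {fset G}) (x : H) : R :=
  \big[Num.max/0]_(s <- S) hnorm (pi s x - x).

(* The infima are taken in \bar R, so that the infimum of the empty set is    *)
(* +oo, not 0 as with the real-valued [inf].                                  *)
Definition kazhdan_rep (R : realType) (G : groupType) (S : {fset G})
    (H : hilbertSpace R) (pi : unitaryRep G H) : \bar R :=
  ereal_inf [set (max_displacement pi S x)%:E
            | x in [set x : H | hnorm x = 1]].

Definition kazhdan (R : realType) (G : groupType) (S : {fset G}) : \bar R :=
  ereal_inf [set k | exists (H : hilbertSpace R) (pi : unitaryRep G H),
                       no_invariant_vector pi /\ k = kazhdan_rep S pi].

Definition generated_subgroup (G : groupType) (S : set G) : set G :=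
  smallest (fun A : set G => group_closed (mem A)) S.

Definition generates (G : groupType) (S : {fset G}) : Prop :=
  generated_subgroup [set` S] = [set: G].

Definition kazhdan_le (R : realType) (G : groupType) (d : nat) : \bar R :=
  ereal_inf [set kazhdan R S
            | S in [set S : {fset G} | generates S /\ (#|` S| <= d)%N]].

Section SpecialLinear.
Variable n : nat.

Record SLZ := MkSLZ { SLZ_mx :> 'M[int]_n; SLZ_det : \det SLZ_mx == 1 }.

HB.instance Definition _ := [isSub for SLZ_mx].
HB.instance Definition _ := [Choice of SLZ by <:].

Lemma SLZ_detE (A : SLZ) : \det A = 1.
Proof. exact/eqP/SLZ_det. Qed.

Lemma SLZ_unitmx (A : SLZ) : (A : 'M[int]_n) \in unitmx.
Proof. by rewrite unitmxE SLZ_detE unitr1. Qed.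

Fact SLZ_mul_subproof (A B : SLZ) : \det (A *m B) == 1.
Proof. by rewrite det_mulmx !SLZ_detE mulr1. Qed.

Fact SLZ_one_subproof : \det (1%:M : 'M[int]_n) == 1.
Proof. by rewrite det1. Qed.

Fact SLZ_inv_subproof (A : SLZ) : \det (invmx A) == 1.
Proof. by rewrite det_inv SLZ_detE invr1. Qed.

Definition SLZ_mul (A B : SLZ) := MkSLZ (SLZ_mul_subproof A B).
Definition SLZ_one := MkSLZ SLZ_one_subproof.
Definition SLZ_inv (A : SLZ) := MkSLZ (SLZ_inv_subproof A).

Fact SLZ_mulgA : associative SLZ_mul.
Proof. by move=> A B C; apply/val_inj; rewrite /= mulmxA. Qed.

Fact SLZ_mul1g : left_id SLZ_one SLZ_mul.
Proof. by move=> A; apply/val_inj; rewrite /= mul1mx. Qed.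

Fact SLZ_mulg1 : right_id SLZ_one SLZ_mul.
Proof. by move=> A; apply/val_inj; rewrite /= mulmx1. Qed.

Fact SLZ_mulVg : left_inverse SLZ_one SLZ_inv SLZ_mul.
Proof. by move=> A; apply/val_inj; rewrite /= mulVmx ?SLZ_unitmx. Qed.

Fact SLZ_mulgV : right_inverse SLZ_one SLZ_inv SLZ_mul.
Proof. by move=> A; apply/val_inj; rewrite /= mulmxV ?SLZ_unitmx. Qed.

HB.instance Definition _ :=
  isGroup.Build SLZ SLZ_mulgA SLZ_mul1g SLZ_mulg1 SLZ_mulVg SLZ_mulgV.

End SpecialLinear.

(* Main.v *)
From HB Require Import structures.
Require Import Defs.
From mathcomp Require Import all_boot all_order all_algebra.
From mathcomp Require Import finmap complex ring lra zify.
From mathcomp Require Import all_classical all_reals all_analysis.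

(** Let [x = E_01(1)] and let [y] be the companion matrix below. They generate
    [SL_n(Z)], hence so do [x] and [z = y x^k] for every [k]. Fix [m], let
    [k = m + 21], and let [H] be the subgroup generated by the conjugates
    [x^i z x^-i] with [0 <= i <= m]. In the representation on
    [l^2(SL_n(Z) / H)] the normalized indicator function of the cosets
    [x^-i H], [0 <= i <= m], is fixed by [z] and is moved by [x] by at most
    [2 / sqrt (m + 1)]. It remains to see that no nontrivial power of [x] lies
    in [H]: then these cosets are distinct and [H] has infinite index, so that
    there is no invariant vector. A reduced word in the generators of [H] is an
    alternating product of powers of [x] and of [y^(+/-1)], where a power of [x]
    is nontrivial between two opposite powers of [y] and has exponent close to
    [+/- k] between two equal powers of [y]. The first kind of subword is
    controlled by a Sanov-type ping-pong between the transvections [x] and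
    [y x y^-1], since the product of the two relevant matrix coefficients of [y]
    and [y^-1] is [+/- 10]; in the second kind the large exponent dominates
    everything else. *)

Set Implicit Arguments.
Unset Strict Implicit.
Unset Printing Implicit Defensive.

Import Order.TTheory GRing.Theory Num.Theory.
Import numFieldNormedType.Exports.

Local Open Scope classical_set_scope.
Local Open Scope ring_scope.
Local Open Scope complex_scope.

(** * The Hilbert space of square-summable sequences *)

Section SquareSummable.
Variable R : realType.
Local Notation C := R[i].
Local Notation reC := (@complex.Re R).
Local Notation imC := (@complex.Im R).
Implicit Types (z w : C) (f g : nat -> C).

Definition normq z : R := reC z ^+ 2 + imC z ^+ 2.

Lemma normqE z : (normq z)%:C = `|z| ^+ 2. Proof. exact: add_Re2_Im2. Qed.

Lemma normq_ge0 z : 0 <= normq z. Proof. by rewrite addr_ge0 ?sqr_ge0. Qed.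

Lemma normq_eq0 z : normq z = 0 -> z = 0.
Proof.
move=> z0; apply/eqP; rewrite -normr_eq0 -sqrf_eq0 -normqE z0.
by apply/eqP.
Qed.

Lemma normqM z w : normq (z * w) = normq z * normq w.
Proof. by case: z w => [a b] [c d]; rewrite /normq /=; ring. Qed.

Lemma normqD z w : normq (z + w) <= 2 * normq z + 2 * normq w.
Proof.
case: z w => [a b] [c d]; rewrite /normq /=.
have := sqr_ge0 (a - c); have := sqr_ge0 (b - d); nra.
Qed.

Definition sqsum f (n : nat) : R := \sum_(i < n) normq (f i).

Lemma sqsumE f : sqsum f = series (normq \o f).
Proof. by apply/funext => n; rewrite seriesEord. Qed.

Lemma sqsum_ge0 f n : 0 <= sqsum f n.
Proof. by apply: sumr_ge0 => i _; exact: normq_ge0. Qed.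

Lemma sqsum_nd f : nondecreasing_seq (sqsum f).
Proof.
by rewrite sqsumE; apply: nondecreasing_series => n _ _; exact: normq_ge0.
Qed.

(** Boundedness of the partial sums amounts to convergence, the terms being nonnegative, and it
    makes closure under linear combinations a termwise estimate. *)
Definition sqsummable : {pred nat -> C} :=
  fun f => `[< exists M, forall n, sqsum f n <= M >].

Lemma sqsummableP f : reflect (exists M, forall n, sqsum f n <= M)
  (f \in sqsummable).
Proof. exact: asboolP. Qed.

Lemma is_cvg_sqsum f : f \in sqsummable -> cvgn (sqsum f).
Proof.
move=> /sqsummableP[M fM]; apply: nondecreasing_is_cvgn; first exact: sqsum_nd.
by exists M => _ [n _ <-].
Qed.

Lemma sqsumD f g n : sqsum (f + g) n <= 2 * sqsum f n + 2 * sqsum g n.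
Proof.
rewrite !mulr_sumr -big_split /=; apply: ler_sum => i _; exact: normqD.
Qed.

Lemma sqsumZ (a : C) f n : sqsum (a *: f) n = normq a * sqsum f n.
Proof. by rewrite mulr_sumr; apply: eq_bigr => i _; rewrite -normqM. Qed.

Lemma sqsummable_submod_closed : submod_closed sqsummable.
Proof.
split.
  by apply/sqsummableP; exists 0 => n; rewrite /sqsum big1// => i _;
    rewrite /normq /= expr0n addr0.
move=> a f g /sqsummableP[M fM] /sqsummableP[N gN]; apply/sqsummableP.
exists (2 * (normq a * M) + 2 * N) => n.
rewrite (le_trans (sqsumD _ _ _))// sqsumZ.
by rewrite lerD// ler_wpM2l// ler_wpM2l// normq_ge0.
Qed.

HB.instance Definition _ :=
  GRing.isSubmodClosed.Build C (nat -> C) sqsummable sqsummable_submod_closed.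

Record l2 := L2 { l2_fun :> nat -> C; l2P : l2_fun \in sqsummable }.

HB.instance Definition _ := [isSub for l2_fun].
HB.instance Definition _ := [Choice of l2 by <:].
HB.instance Definition _ := [SubChoice_isSubLmodule of l2 by <:].

Implicit Types u v : l2.

Definition csummable (c : nat -> C) : Prop :=
  cvgn (series (reC \o c)) /\ cvgn (series (imC \o c)).

Definition csum (c : nat -> C) : C :=
  limn (series (reC \o c)) +i* limn (series (imC \o c)).

Let reD z w : reC (z + w) = reC z + reC w. Proof. by case: z w => ? ? []. Qed.
Let imD z w : imC (z + w) = imC z + imC w. Proof. by case: z w => ? ? []. Qed.
Let reM z w : reC (z * w) = reC z * reC w - imC z * imC w.
Proof. by case: z w => ? ? []. Qed.
Let imM z w : imC (z * w) = reC z * imC w + imC z * reC w.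
Proof. by case: z w => ? ? []. Qed.

Let imJ z : imC z^* = - imC z. Proof. by case: z. Qed.

Lemma csumD (c d : nat -> C) : csummable c -> csummable d ->
  csum (c + d) = csum c + csum d.
Proof.
move=> [c1 c2] [d1 d2]; rewrite /csum.
have -> : reC \o (c + d) = (reC \o c) + (reC \o d).
  by apply/funext => i; exact: reD.
have -> : imC \o (c + d) = (imC \o c) + (imC \o d).
  by apply/funext => i; exact: imD.
by rewrite !lim_seriesD.
Qed.

Lemma csummableZ (a : C) (c : nat -> C) : csummable c -> csummable (a *: c).
Proof.
move=> [c1 c2]; split.
- rewrite (_ : _ \o _ = reC a *: (reC \o c) - imC a *: (imC \o c)).
    by apply: is_cvg_seriesB; exact: is_cvg_seriesZ.
  by apply/funext => i; exact: reM.
- rewrite (_ : _ \o _ = reC a *: (imC \o c) + imC a *: (reC \o c)).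
    by apply: is_cvg_seriesD; exact: is_cvg_seriesZ.
  by apply/funext => i; exact: imM.
Qed.

Lemma csumZ (a : C) (c : nat -> C) : csummable c -> csum (a *: c) = a * csum c.
Proof.
move=> [c1 c2]; rewrite /csum.
have -> : reC \o (a *: c) = (reC a *: (reC \o c)) - (imC a *: (imC \o c)).
  by apply/funext => i; exact: reM.
have -> : imC \o (a *: c) = (reC a *: (imC \o c)) + (imC a *: (reC \o c)).
  by apply/funext => i; exact: imM.
rewrite lim_seriesB ?lim_seriesD; try exact: is_cvg_seriesZ.
by rewrite !lim_seriesZ//; case: a.
Qed.

Lemma csumJ (c : nat -> C) : csummable c ->
  csum (fun i => (c i)^* ) = (csum c)^*.
Proof.
move=> [c1 c2]; rewrite /csum /=.
have -> : reC \o (fun i => (c i)^* ) = reC \o c.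
  by apply/funext => i /=; case: (c i).
have -> : imC \o (fun i => (c i)^* ) = - (imC \o c).
  by apply/funext => i; exact: imJ.
by rewrite lim_seriesN.
Qed.

(** Comparison test: the real and imaginary parts of each term are at most
    [normq (f i) + normq (g i)] in absolute value, by nonnegativity of suitable squares. *)
Lemma csummableM f g : f \in sqsummable -> g \in sqsummable ->
  csummable (fun i => f i * (g i)^* ).
Proof.
move=> f2 g2.
have fg : cvgn (series ((normq \o f) + (normq \o g))).
  by apply: is_cvg_seriesD; rewrite -sqsumE; exact: is_cvg_sqsum.
have le_cvg (h : nat -> R) :
    (forall i, `|h i| <= normq (f i) + normq (g i)) -> cvgn (series h).
  move=> hfg; apply: normed_cvg; apply: series_le_cvg fg => [i|i|i].
  - exact: normr_ge0.
  - by apply: addr_ge0; exact: normq_ge0.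
  - exact: hfg.
split; apply: le_cvg => i /=; case: (f i) (g i) => [a b] [c d];
  rewrite /normq /= ler_norml.
- have := sqr_ge0 (a - c); have := sqr_ge0 (b - d).
  by have := sqr_ge0 (a + c); have := sqr_ge0 (b + d) => *; apply/andP; split; nra.
- have := sqr_ge0 (a - d); have := sqr_ge0 (b - c).
  by have := sqr_ge0 (a + d); have := sqr_ge0 (b + c) => *; apply/andP; split; nra.
Qed.

Definition l2_dot u v : C := csum (fun i => u i * (v i)^* ).

Lemma l2_dot_linearl v : scalar (l2_dot^~ v).
Proof.
move=> a u w; rewrite /l2_dot.
have -> : (fun i => (a *: u + w) i * (v i)^* ) =
   a *: (fun i => u i * (v i)^* ) + (fun i => w i * (v i)^* ).
  by apply/funext => i; rewrite !fctE mulrDl -mulrA.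
have cu := csummableM (l2P u) (l2P v); have cw := csummableM (l2P w) (l2P v).
by rewrite csumD // ?csumZ //; exact: csummableZ.
Qed.

Lemma l2_dotC u v : l2_dot u v = (l2_dot v u)^*.
Proof.
rewrite -csumJ; last exact: csummableM (l2P v) (l2P u).
by congr csum; apply/funext => i; rewrite rmorphM /= conjcK mulrC.
Qed.

Lemma l2_dotE u : l2_dot u u = (limn (sqsum u))%:C.
Proof.
rewrite /l2_dot /csum sqsumE.
have -> : reC \o (fun i => u i * (u i)^* ) = (@normq) \o u.
  by apply/funext => i /=; case: (u i) => a b; rewrite /normq /=; ring.
have -> : imC \o (fun i => u i * (u i)^* ) = 0.
  by apply/funext => i; rewrite /= -[RHS]/(0 : R); case: (u i) => a b /=; ring.
congr Complex; rewrite (_ : series 0 = cst 0) ?lim_cst//.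
by apply/funext => n; rewrite /series /= big1.
Qed.

Lemma le_lim_sqsum u n : sqsum u n <= limn (sqsum u).
Proof.
apply: nondecreasing_cvgn_le; first exact: sqsum_nd.
exact: is_cvg_sqsum (l2P u).
Qed.

Lemma lim_sqsum_le u M : (forall n, sqsum u n <= M) -> limn (sqsum u) <= M.
Proof.
move=> uM; apply: limr_le; first exact: is_cvg_sqsum (l2P u).
by apply: nearW.
Qed.

Lemma lim_sqsum_ge0 u : 0 <= limn (sqsum u).
Proof. exact: le_trans (sqsum_ge0 u 0) (le_lim_sqsum u 0). Qed.

Lemma lim_sqsum_eq0 u : limn (sqsum u) = 0 -> u = 0.
Proof.
move=> u0; apply/val_inj/funext => i /=; apply: normq_eq0; apply/eqP.
rewrite eq_le normq_ge0 andbT -u0 (le_trans _ (le_lim_sqsum u i.+1))//.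
by rewrite /sqsum big_ord_recr /= lerDr sqsum_ge0.
Qed.

Lemma l2_dot_linearr u : linear_for (@Num.conj C \; ( *%R )) (l2_dot u).
Proof.
move=> a v w; rewrite l2_dotC (l2_dotC u v) (l2_dotC u w).
by rewrite l2_dot_linearl rmorphD rmorphM.
Qed.

HB.instance Definition _ := @bilinear_isBilinear.Build C l2 l2 C ( *%R )
  (@Num.conj C \; ( *%R )) l2_dot (l2_dot_linearl, l2_dot_linearr).

Lemma l2_dot_hermitian u v : l2_dot u v = (-1) ^+ false * Num.conj (l2_dot v u).
Proof. by rewrite expr0 mul1r l2_dotC. Qed.

HB.instance Definition _ := isHermitianSesquilinear.Build C l2 false
  (@Num.conj C) l2_dot l2_dot_hermitian.

Lemma l2_dot_gt0 u : u != 0 -> 0 < l2_dot u u.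
Proof.
move=> u0; rewrite l2_dotE lt0r ler0c lim_sqsum_ge0 andbT.
by apply: contra_neq u0 => /complexI; exact: lim_sqsum_eq0.
Qed.

HB.instance Definition _ := isDotProduct.Build C l2 l2_dot l2_dot_gt0.

End SquareSummable.

Arguments l2_dot : simpl never.

(** * The norm of [l2] and the Cauchy-Schwarz inequality *)

Section L2Norm.
Variable R : realType.
Local Notation C := R[i].
Local Notation reC := (@complex.Re R).
Local Notation l2 := (l2 R).
Implicit Types u v w : l2.

Definition l2_norm u : R := Num.sqrt (limn (sqsum u)).

Lemma l2_norm_ge0 u : 0 <= l2_norm u. Proof. exact: sqrtr_ge0. Qed.

Lemma l2_norm_sqr u : l2_norm u ^+ 2 = limn (sqsum u).
Proof. by rewrite sqr_sqrtr // lim_sqsum_ge0. Qed.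

Lemma l2_dot_norm u : l2_dot u u = (l2_norm u)%:C ^+ 2.
Proof. by rewrite l2_dotE -l2_norm_sqr rmorphXn. Qed.

Lemma l2_norm_sqrE u : l2_norm u ^+ 2 = reC (l2_dot u u).
Proof. by rewrite l2_dotE l2_norm_sqr. Qed.

Lemma l2_dotDl u v w : l2_dot (u + v) w = l2_dot u w + l2_dot v w.
Proof. by have := l2_dot_linearl w 1 u v; rewrite scale1r => ->; rewrite mul1r. Qed.

Lemma l2_dotZl (a : C) u v : l2_dot (a *: u) v = a * l2_dot u v.
Proof. exact: linearZl_LR. Qed.

Lemma l2_dotDr u v w : l2_dot u (v + w) = l2_dot u v + l2_dot u w.
Proof. by rewrite l2_dotC l2_dotDl rmorphD (l2_dotC u v) (l2_dotC u w). Qed.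

Lemma l2_dotZr (a : C) u v : l2_dot u (a *: v) = a^* * l2_dot u v.
Proof. by rewrite l2_dotC (l2_dotC u v) l2_dotZl rmorphM. Qed.

Lemma l2_norm_sqrD (a b : R) u v :
  l2_norm (a%:C *: u + b%:C *: v) ^+ 2 =
  a ^+ 2 * l2_norm u ^+ 2 + 2 * a * b * reC (l2_dot u v)
  + b ^+ 2 * l2_norm v ^+ 2.
Proof.
rewrite !l2_norm_sqrE l2_dotDl !l2_dotDr !l2_dotZl !l2_dotZr.
rewrite (l2_dotC v u).
case: (l2_dot u v) (l2_dot u u) (l2_dot v v) => [p q] [r s] [t w] /=.
by ring.
Qed.

(** Cauchy-Schwarz for the real part, which is all that the triangle inequality uses. If [a] and [b]
    are the norms of [u] and [v] and [c] is the real part, then [b u - a v] has squared norm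
    [2ab(ab - c)]. *)
Lemma l2_re_dot_le u v : reC (l2_dot u v) <= l2_norm u * l2_norm v.
Proof.
have [u0|u0] := eqVneq (l2_norm u) 0.
  have -> : u = 0 by apply: lim_sqsum_eq0; rewrite -l2_norm_sqr u0 expr0n.
  by rewrite linear0l /= mulr_ge0 // l2_norm_ge0.
have [v0|v0] := eqVneq (l2_norm v) 0.
  have -> : v = 0 by apply: lim_sqsum_eq0; rewrite -l2_norm_sqr v0 expr0n.
  by rewrite linear0r /= mulr_ge0 // l2_norm_ge0.
have := sqr_ge0 (l2_norm ((l2_norm v)%:C *: u + (- l2_norm u)%:C *: v)).
rewrite l2_norm_sqrD.
have : 0 < l2_norm u * l2_norm v by rewrite mulr_gt0// lt0r ?u0 ?v0 l2_norm_ge0.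
set a := l2_norm u; set b := l2_norm v; set c := reC _ => ab H.
rewrite -(ler_pM2l ab); nra.
Qed.

Lemma l2_normD u v : l2_norm (u + v) <= l2_norm u + l2_norm v.
Proof.
rewrite -(@ler_pXn2r _ 2) ?nnegrE ?addr_ge0 ?l2_norm_ge0 //.
have := l2_norm_sqrD 1 1 u v; rewrite rmorph1 !scale1r => ->.
have := l2_re_dot_le u v; nra.
Qed.

Lemma l2_normZ (a : C) u : l2_norm (a *: u) = reC `|a| * l2_norm u.
Proof.
have a0 : 0 <= reC `|a| by rewrite normc_def /= sqrtr_ge0.
apply/eqP; rewrite -(@eqrXn2 _ 2) ?mulr_ge0 ?l2_norm_ge0 //; apply/eqP.
rewrite exprMn !l2_norm_sqr.
have -> : sqsum (a *: u) = reC `|a| ^+ 2 *: sqsum u.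
  apply/funext => n; rewrite sqsumZ; congr (_ * _).
  by rewrite normc_def /= sqr_sqrtr // addr_ge0 ?sqr_ge0.
by rewrite limZl_tmp //; exact: is_cvg_sqsum (l2P u).
Qed.

Lemma l2_norm_eq0 u : l2_norm u = 0 -> u = 0.
Proof. by move=> u0; apply: lim_sqsum_eq0; rewrite -l2_norm_sqr u0 expr0n. Qed.

Let normC u : C := (l2_norm u)%:C.

Let normCD u v : normC (u + v) <= normC u + normC v.
Proof. by rewrite -rmorphD lecR l2_normD. Qed.

Let normCZ (a : C) u : normC (a *: u) = `|a| * normC u.
Proof. by rewrite /normC l2_normZ normc_def /= -rmorphM. Qed.

Let normC0 u : normC u = 0 -> u = 0.
Proof. by move=> /complexI; exact: l2_norm_eq0. Qed.

HB.instance Definition _ := @Lmodule_isNormed.Build C l2 normC normCD normCZ normC0.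

Lemma l2_normE u : `|u| = (l2_norm u)%:C. Proof. by []. Qed.

End L2Norm.

(** * Completeness of [l2] *)

Section L2Complete.
Variable R : realType.
Local Notation C := R[i].
Local Notation reC := (@complex.Re R).
Local Notation imC := (@complex.Im R).
Local Notation l2 := (l2 R).
Implicit Types u v w : l2.

Lemma normq_le_l2_norm u i : normq (u i) <= l2_norm u ^+ 2.
Proof.
rewrite l2_norm_sqr (le_trans _ (le_lim_sqsum u i.+1))//.
by rewrite /sqsum big_ord_recr /= lerDr sqsum_ge0.
Qed.

Lemma l2_ballE u (e : R) v : ball u e%:C v = (l2_norm (u - v) < e) :> Prop.
Proof. by rewrite -ball_normE /= l2_normE ltcR. Qed.

Lemma gt0_complexE (e : C) : 0 < e -> 0 < reC e /\ e = (reC e)%:C.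
Proof. by case: e => x y; rewrite ltcE /= => /andP[/eqP -> ->]. Qed.

Let reB (z w : C) : reC (z - w) = reC z - reC w.
Proof. by case: z w => ? ? []. Qed.
Let imB (z w : C) : imC (z - w) = imC z - imC w.
Proof. by case: z w => ? ? []. Qed.

(** Coordinates are 1-Lipschitz, so they converge along [F] to some sequence [g]. A bound on
    finitely many coordinates of [x - y] passes to the limit in [y], and it is uniform in their
    number; hence [x - g], and with it [g], is square-summable, and the convergence is in norm. *)
Lemma l2_complete (F : set_system l2) : ProperFilter F -> cauchy F -> cvg F.
Proof.
move=> FF Fc.
have Fex (e : R) : 0 < e -> exists x : l2, F [set y | l2_norm (x - y) < e].
  move=> e0; have /cauchyP/(_ e%:C) [|x xF] := Fc; first by rewrite ltcR.
  by exists x; apply: filterS xF => y; rewrite l2_ballE.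
have ptw (h : l2 -> R) :
    (forall u v, `|h u - h v| <= l2_norm (u - v)) -> cvg (h @ F).
  move=> hle; apply/cauchy_cvgP/cauchyP => e e0.
  have [x xF] := Fex e e0; exists (h x).
  change (F (h @^-1` ball (h x) e)).
  apply: filterS xF => y /= xy; rewrite -ball_normE /=; exact: le_lt_trans (hle _ _) xy.
have sqle (a : R) z u i : a ^+ 2 <= normq z -> z = u i -> `|a| <= l2_norm u.
  move=> az zu; rewrite -(@ler_pXn2r _ 2) ?nnegrE ?l2_norm_ge0//.
  by rewrite real_normK ?num_real// (le_trans az)// zu normq_le_l2_norm.
have re_cvg i : cvg ((fun y : l2 => reC (y i)) @ F).
  apply: ptw => u v; apply: (sqle _ _ _ i) (erefl _).
  by rewrite /normq -(reB (u i) (v i)) lerDl sqr_ge0.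
have im_cvg i : cvg ((fun y : l2 => imC (y i)) @ F).
  apply: ptw => u v; apply: (sqle _ _ _ i) (erefl _).
  by rewrite /normq -(imB (u i) (v i)) lerDr sqr_ge0.
pose g (i : nat) : C := lim ((fun y : l2 => reC (y i)) @ F) +i*
            lim ((fun y : l2 => imC (y i)) @ F).
have xg (x : l2) (e : R) : 0 < e -> F [set y | l2_norm (x - y) < e] ->
    forall n, sqsum ((x : nat -> C) - g) n <= e ^+ 2.
  move=> e0 xF n.
  have sq_cvg : (fun y : l2 => sqsum (x - y) n) @ F -->
                sqsum ((x : nat -> C) - g) n.
    apply: cvg_big => [|i _]; first exact: add_continuous.
    rewrite (_ : (fun y : l2 => normq ((x - y) i)) =
      (fun y : l2 => (reC (x i) - reC (y i)) ^+ 2 +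
                     (imC (x i) - imC (y i)) ^+ 2)); last first.
      by apply/funext => y; rewrite -reB -imB.
    rewrite (_ : normq _ = (reC (x i) - reC (g i)) ^+ 2 +
                     (imC (x i) - imC (g i)) ^+ 2); last first.
      by rewrite -reB -imB.
    by apply: cvgD; apply: cvgM; apply: cvgB; try exact: cvg_cst;
      [exact: re_cvg | exact: re_cvg | exact: im_cvg | exact: im_cvg].
  rewrite -(cvg_lim _ sq_cvg)//; apply: limr_le; first exact: cvgP sq_cvg.
  apply: filterS xF => y /= xy.
  apply: (le_trans (le_lim_sqsum (x - y) n)); rewrite -l2_norm_sqr.
  by rewrite ler_pXn2r ?nnegrE ?l2_norm_ge0 // ltW.
have g2 : g \in @sqsummable R.
  have [x xF] := Fex 1 ltr01.
  rewrite (_ : g = (x : nat -> C) - ((x : nat -> C) - g)); last by rewrite opprB addrC subrK.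
  apply: rpredB; first exact: l2P.
  by apply/sqsummableP; exists (1 ^+ 2); exact: xg xF.
apply/cvg_ex; exists (L2 g2); apply/cvg_ballP => e /gt0_complexE[e0 ->].
have e20 : 0 < reC e / 2 by rewrite divr_gt0.
have [x xF] := Fex _ e20.
apply: filterS (xF) => y /= xy; rewrite l2_ballE.
rewrite -[L2 g2](subrK x) -addrA (le_lt_trans (l2_normD _ _))//.
rewrite (splitr (reC e)) ler_ltD //.
rewrite -opprB -scaleN1r l2_normZ normrN1 mul1r.
rewrite -(@ler_pXn2r _ 2) ?nnegrE ?l2_norm_ge0 ?(ltW e20)//.
by rewrite l2_norm_sqr; apply: lim_sqsum_le => n; exact: xg xF n.
Qed.

HB.instance Definition _ := Uniform_isComplete.Build l2 l2_complete.

Lemma l2_inner_normE u : l2_dot u u = `|u| ^+ 2.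
Proof. by rewrite l2_dot_norm l2_normE. Qed.

Definition l2_hilbert : hilbertSpace R := HilbertSpace l2_inner_normE.

End L2Complete.

(** * Permutation representations *)

Section L2Perm.
Variable R : realType.
Local Notation C := R[i].
Local Notation reC := (@complex.Re R).
Local Notation imC := (@complex.Im R).
Local Notation l2 := (l2 R).
Implicit Types u v w : l2.

(** This serves twice: it bounds the partial sums of a sequence reindexed by an injection, and it
    bounds from below the norm of a sum of distinct point masses. *)
Lemma sum_normq_le u (s : seq nat) : uniq s ->
  \sum_(j <- s) normq (u j) <= l2_norm u ^+ 2.
Proof.
move=> us; pose M := (\max_(j <- s) j).+1.
have sM j : j \in s -> (j < M)%N by move=> js; rewrite ltnS; exact: leq_bigmax_seq.
rewrite l2_norm_sqr (le_trans _ (le_lim_sqsum u M))//.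
rewrite /sqsum -(big_mkord xpredT (fun j => normq (u j))).
have sE : perm_eq s [seq j <- index_iota 0 M | j \in s].
  apply: uniq_perm => //; first by rewrite filter_uniq ?iota_uniq.
  move=> j; rewrite mem_filter mem_index_iota /=.
  by case: (boolP (j \in s)) => //= /sM ->.
rewrite [leLHS](perm_big _ sE) big_filter big_mkcond; apply: ler_sum => j _.
by case: ifP => _ //; exact: normq_ge0.
Qed.

Section Perm.
Variables (p : nat -> nat) (p_inj : injective p).

Lemma sqsum_perm_le u n : sqsum (u \o p) n <= l2_norm u ^+ 2.
Proof.
rewrite /sqsum -(big_mkord xpredT (fun j => normq (u (p j)))).
rewrite -(big_map p xpredT (fun j => normq (u j))).
by apply: sum_normq_le; rewrite map_inj_uniq ?iota_uniq.
Qed.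

Fact l2_perm_subproof u : (u \o p) \in @sqsummable R.
Proof. by apply/sqsummableP; exists (l2_norm u ^+ 2); exact: sqsum_perm_le. Qed.

Definition l2_perm u : l2 := L2 (l2_perm_subproof u).

Lemma l2_perm_linear : linear l2_perm.
Proof. by move=> a u v; apply/val_inj. Qed.

HB.instance Definition _ := GRing.isLinear.Build C l2 l2 _ l2_perm l2_perm_linear.

Lemma l2_norm_perm_le u : l2_norm (l2_perm u) <= l2_norm u.
Proof.
rewrite -(@ler_pXn2r _ 2) ?nnegrE ?l2_norm_ge0// [leLHS]l2_norm_sqr.
by apply: lim_sqsum_le; exact: sqsum_perm_le.
Qed.

End Perm.

(** The norm does not increase under [p] nor under its inverse [q], so it is preserved. Polarization
    then gives the real part of the inner product, and replacing [v] by ['i *: v] gives the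
    imaginary part. *)
Lemma l2_perm_unitary (p q : nat -> nat) (p_inj : injective p)
    (q_inj : injective q) : cancel q p ->
  forall u v, l2_dot (l2_perm p_inj u) (l2_perm p_inj v) = l2_dot u v.
Proof.
move=> qK u v.
have nE w : l2_norm (l2_perm p_inj w) = l2_norm w.
  apply/eqP; rewrite eq_le l2_norm_perm_le /=.
  suff {1}-> : w = l2_perm q_inj (l2_perm p_inj w) by exact: l2_norm_perm_le.
  by apply/val_inj/funext => i /=; rewrite qK.
have reE w x :
    reC (l2_dot (l2_perm p_inj w) (l2_perm p_inj x)) = reC (l2_dot w x).
  have := congr1 (fun a => a ^+ 2) (nE (1%:C *: w + 1%:C *: x)).
  have -> : l2_perm p_inj (1%:C *: w + 1%:C *: x) =
    1%:C *: l2_perm p_inj w + 1%:C *: l2_perm p_inj x by apply/val_inj.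
  rewrite /= (l2_norm_sqrD 1 1 w x) (l2_norm_sqrD 1 1 (l2_perm p_inj w)) !nE.
  by move=> /addIr/addrI; apply: mulfI; rewrite !mulr1 pnatr_eq0.
apply/eqP; rewrite eq_complex; apply/andP; split; apply/eqP; first exact: reE.
have := reE u ('i *: v).
have -> : l2_perm p_inj ('i *: v) = 'i *: l2_perm p_inj v by apply/val_inj.
rewrite !l2_dotZr; case: (l2_dot _ _) => a b; case: (l2_dot _ _) => c d /=.
by rewrite !mul0r !sub0r !mulN1r !opprK.
Qed.

Lemma sqsum_delta_le (a n : nat) : sqsum (fun i => (i == a)%:R : C) n <= 1.
Proof.
have d0 (i : nat) : i != a -> normq ((i == a)%:R : C) = 0.
  by move=> /negbTE ->; rewrite /normq /= expr0n addr0.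
rewrite /sqsum; have [an|na] := ltnP a n.
  rewrite (bigD1 (Ordinal an)) //= big1 => [|i ia]; last exact: d0.
  by rewrite eqxx /normq /= expr1n expr0n !addr0.
by rewrite big1 // => i _; apply: d0; rewrite ltn_eqF // (leq_trans _ na).
Qed.

Fact l2_delta_subproof (a : nat) : (fun i => (i == a)%:R : C) \in @sqsummable R.
Proof. by apply/sqsummableP; exists 1; exact: sqsum_delta_le. Qed.

Definition l2_delta (a : nat) : l2 := L2 (l2_delta_subproof a).

Lemma l2_norm_delta a : l2_norm (l2_delta a) <= 1.
Proof.
rewrite -(@ler_pXn2r _ 2) ?nnegrE ?l2_norm_ge0 // l2_norm_sqr expr1n.
by apply: lim_sqsum_le; exact: sqsum_delta_le.
Qed.

Lemma l2_perm_delta (p q : nat -> nat) (p_inj : injective p) : cancel p q ->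
  cancel q p -> forall a, l2_perm p_inj (l2_delta a) = l2_delta (q a).
Proof.
move=> pK qK a; apply/val_inj/funext => i /=.
by rewrite -[X in _ == X]qK (inj_eq p_inj).
Qed.

Lemma l2_norm_sum_delta (m : nat) (a : nat -> nat) : injective a ->
  m%:R <= l2_norm (\sum_(i < m) l2_delta (a i)) ^+ 2.
Proof.
move=> a_inj; set u := \sum_(i < m) _.
have us : uniq [seq a i | i <- iota 0 m] by rewrite map_inj_uniq ?iota_uniq.
apply: le_trans (sum_normq_le u us); rewrite big_map.
rewrite -[X in iota 0 X](subn0 m) -/(index_iota 0 m) big_mkord.
have uE j : u j = \sum_(i < m) (j == a i)%:R.
  rewrite /u; elim/big_ind2 : _ => // [v b w c <- <-] //.
rewrite (eq_bigr (fun=> 1)) ?sumr_const ?card_ord// => i _.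
rewrite uE (bigD1 i) //= big1 => [|k ki].
  by rewrite eqxx addr0 /normq /= expr1n expr0n addr0.
by rewrite (inj_eq a_inj) eq_sym (inj_eq val_inj) (negbTE ki).
Qed.

End L2Perm.

(** * Unitary representations from actions on the natural numbers *)

Section NatAction.
Variables (R : realType) (G : groupType) (act : G -> nat -> nat).
Hypothesis act1 : forall i, act 1%g i = i.
Hypothesis actM : forall g h i, act (g * h)%g i = act g (act h i).
Local Notation C := R[i].
Local Notation l2 := (l2 R).

Lemma act_inv g : cancel (act g) (act g^-1%g).
Proof. by move=> i; rewrite -actM mulVg act1. Qed.

Lemma act_invV g : cancel (act g^-1%g) (act g).
Proof. by move=> i; rewrite -actM mulgV act1. Qed.

Let H := l2_hilbert R.

(** Precomposition reverses products, so [g] acts through [g^-1]; the point mass at [a] then moves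
    to the one at [act g a]. *)
Definition l2_act (g : G) : {linear H -> H} := l2_perm (can_inj (act_invV g)).

Lemma l2_act_unitary g : unitary_op (l2_act g).
Proof.
split.
  move=> u v; exact: (@l2_perm_unitary R _ _ _ (can_inj (act_inv g)) (act_inv g)) u v.
exists (l2_perm (can_inj (act_inv g))) => u; apply/val_inj/funext => i /=.
  by rewrite act_inv.
by rewrite act_invV.
Qed.

Lemma l2_act1 u : l2_act 1%g u = u.
Proof. by apply/val_inj/funext => i /=; rewrite invg1 act1. Qed.

Lemma l2_actM g h u : l2_act (g * h)%g u = l2_act g (l2_act h u).
Proof. by apply/val_inj/funext => i /=; rewrite invgM actM. Qed.

Definition l2_rep : unitaryRep G H := UnitaryRep l2_act_unitary l2_act1 l2_actM.

Lemma l2_rep_delta g a : l2_rep g (l2_delta R a) = l2_delta R (act g a).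
Proof. exact: (@l2_perm_delta R _ _ (can_inj (act_invV g)) (act_invV g) (act_inv g) a). Qed.

(** By transitivity an invariant vector is a constant sequence, and a nonzero constant is not
    square-summable over the infinite set [nat]. *)
Lemma l2_rep_no_invariant : (forall i j, exists g, act g i = j) ->
  no_invariant_vector l2_rep.
Proof.
move=> act_trans u u_inv.
have u_cst j : l2_fun u j = l2_fun u 0%N.
  have [g gj] := act_trans j 0%N.
  have := congr1 (fun v : l2 => l2_fun v (act g j)) (u_inv g).
  by rewrite /= act_inv gj.
have /sqsummableP[M uM] := l2P u.
apply/val_inj/funext => j /=; rewrite u_cst; apply: normq_eq0.
apply/eqP; rewrite eq_le normq_ge0 andbT leNgt; apply/negP => u0.
have [n nM] : exists n : nat, M < n%:R * normq (l2_fun u 0%N).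
  have [n Mn] : exists n : nat, M / normq (l2_fun u 0%N) < n%:R.
    exists (Num.bound (M / normq (l2_fun u 0%N))); apply: archi_boundP.
    by rewrite divr_ge0 ?normq_ge0 // (le_trans (sqsum_ge0 u 0)).
  by exists n; rewrite -ltr_pdivrMr.
have := uM n; rewrite leNgt /sqsum (eq_bigr (fun=> normq (l2_fun u 0%N))).
  by rewrite sumr_const card_ord -mulr_natl nM.
by move=> i _; rewrite u_cst.
Qed.

Lemma kazhdan_le_of_action (s t : G) (a : nat -> nat) (m : nat) :
  (forall i j, exists g, act g i = j) -> injective a ->
  (forall i, act s (a i.+1) = a i) ->
  (forall i, (i < m.+1)%N -> act t (a i) = a i) ->
  (kazhdan R [fset s; t]%fset <= (2 / Num.sqrt m.+1%:R)%:E)%E.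
Proof.
move=> act_trans a_inj sa ta.
pose u : l2 := \sum_(i < m.+1) l2_delta R (a i).
have u_ge : Num.sqrt m.+1%:R <= l2_norm u.
  rewrite -[leRHS]ger0_norm ?l2_norm_ge0 // -sqrtr_sqr ler_wsqrtr //.
  exact: l2_norm_sum_delta.
have sqrt_gt0 : 0 < Num.sqrt m.+1%:R :> R by rewrite sqrtr_gt0 ltr0n.
have u_gt0 : 0 < l2_norm u := lt_le_trans sqrt_gt0 u_ge.
have repD g : l2_rep g u = \sum_(i < m.+1) l2_delta R (act g (a i)).
  by rewrite linear_sum; apply: eq_bigr => i _; exact: l2_rep_delta.
have tu : l2_rep t u - u = 0.
  apply/eqP; rewrite subr_eq0 repD; apply/eqP; apply: eq_bigr => i _.
  by rewrite ta.
have su : l2_norm (l2_rep s u - u) <= 2.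
  (* The vector [u] and its image under [s] share the point masses at [a i] for [i < m]; only those
     at [act s (a 0)] and [a m] survive in the difference. *)
  rewrite repD big_ord_recl /u big_ord_recr /=.
  rewrite (eq_bigr (fun i : 'I_m => l2_delta R (a i))); last first.
    by move=> i _; rewrite -[bump 0 i]/(i.+1) sa.
  rewrite opprD addrA addrK.
  apply: (le_trans (l2_normD _ _)); rewrite -scaleN1r l2_normZ normrN1 mul1r.
  have -> : 2 = 1 + 1 :> R by [].
  by apply: lerD; exact: l2_norm_delta.
pose c : C := (l2_norm u)^-1%:C.
pose x : l2_hilbert R := c *: u.
have cE : complex.Re `|c| = (l2_norm u)^-1.
  by rewrite normc_def /= expr0n addr0 sqrtr_sqr ger0_norm // invr_ge0 ltW.
have x1 : hnorm x = 1.
  by rewrite -[hnorm x]/(l2_norm (c *: u)) l2_normZ cE mulVf ?gt_eqF.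
have dispE g : hnorm (l2_rep g x - x) = (l2_norm u)^-1 * l2_norm (l2_rep g u - u).
  rewrite -[LHS]/(l2_norm (l2_act g (c *: u) - c *: u)).
  by rewrite linearZ -scalerBr l2_normZ cE.
apply: ge_ereal_inf; exists (kazhdan_rep [fset s; t]%fset l2_rep).
  exists (l2_hilbert R), l2_rep; split => //; exact: l2_rep_no_invariant.
apply: ge_ereal_inf; exists (max_displacement l2_rep [fset s; t]%fset x)%:E.
  by exists x.
have sqrt_le : (l2_norm u)^-1 * 2 <= 2 / Num.sqrt m.+1%:R.
  by rewrite mulrC ler_pM2l // lef_pV2.
rewrite lee_fin /max_displacement big_seq; elim/big_ind : _ => [|y z yle zle|g].
- by rewrite divr_ge0.
- by rewrite ge_max yle.
- rewrite dispE !inE => /orP[/eqP ->|/eqP ->].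
    by rewrite (le_trans _ sqrt_le) // ler_pM2l ?invr_gt0.
  rewrite tu (_ : l2_norm 0 = 0) ?mulr0 ?divr_ge0 //.
  by rewrite -(scale0r u) l2_normZ normr0 mul0r.
Qed.

End NatAction.

(** * The action on the left cosets of a subgroup *)

Section CosetAction.
Variables (G : groupType) (code : G -> nat) (H : set G).
Hypotheses (code_inj : injective code) (H1 : H 1%g).
Hypothesis HM : forall x y, H x -> H y -> H (x * y)%g.
Hypothesis HV : forall x, H x -> H x^-1%g.
Local Open Scope group_scope.

Let coset (x : G) : set G := [set y | H (x^-1 * y)].

Let cosetE x y : coset x = coset y <-> H (x^-1 * y).
Proof.
split=> [E|Hxy].
  have : coset y y by rewrite /coset /= mulVg.
  by rewrite -E.
apply/seteqP; split => z; rewrite /coset /= => Hz.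
- have -> : y^-1 * z = (x^-1 * y)^-1 * (x^-1 * z) by rewrite invgM invgK mulgA mulgK.
  by apply: HM => //; exact: HV.
- have -> : x^-1 * z = (x^-1 * y) * (y^-1 * z) by rewrite mulgA mulgK.
  exact: HM.
Qed.

Let coset_expg_inj (s : G) : (forall p, (0 < p)%N -> ~ H (s ^+ p)) ->
  injective (fun i => coset (s ^+ i)).
Proof.
move=> sH.
have lt_neq i j : (i < j)%N -> coset (s ^+ i) <> coset (s ^+ j).
  move=> ij /cosetE Hs; apply: (sH (j - i)%N); first by rewrite subn_gt0.
  by rewrite -{1}(subnKC (ltnW ij)) expgnDr mulKg in Hs.
by move=> i j sij; have [/lt_neq|/lt_neq/nesym|] := ltngtP i j.
Qed.

(** The cosets are countable, since [G] is, and infinite, since the powers of [s] lie in distinct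
    cosets. They are thus numbered by all of [nat], the index set of [l2]. *)
Lemma coset_enumeration (s : G) : (forall p, (0 < p)%N -> ~ H (s ^+ p)) ->
  exists c : G -> nat, (forall j, exists x, c x = j) /\
    (forall x y, c x = c y <-> H (x^-1 * y)).
Proof.
move=> sH.
have ctb : countable (range coset).
  apply: (@sub_countable _ _ _ [set: G]); first exact: card_image_le.
  by apply/countable_injP; exists code => x y _ _; exact: code_inj.
have inf : ([set: nat] #<= range coset)%card.
  apply: (@card_le_trans _ _ _ ((fun i => coset (s ^+ i)) @` [set: nat])).
    have /card_eqPle[] // := inj_card_eq (A := [set: nat])
      (fun i j _ _ => @coset_expg_inj s sH i j).
  by apply: subset_card_le => _ [i _ <-]; exists (s ^+ i).
have /card_set_bijP[f [fS f_inj f_surj]] : (range coset #= [set: nat])%card.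
  by rewrite card_eq_le; apply/andP; split.
exists (f \o coset); split.
  by move=> j; have [_ [x _ <-] <-] := f_surj j I; exists x.
move=> x y; rewrite -cosetE; split=> [|/= ->//].
by apply: f_inj; rewrite inE; [exists x|exists y].
Qed.

Lemma coset_action (s : G) : (forall p, (0 < p)%N -> ~ H (s ^+ p)) ->
  exists (c : G -> nat) (act : G -> nat -> nat),
   [/\ forall i, act 1 i = i,
       forall g h i, act (g * h) i = act g (act h i),
       forall i j, exists g, act g i = j,
       forall x y, c x = c y <-> H (x^-1 * y)
     & forall g x, act g (c x) = c (g * x) ].
Proof.
move=> /coset_enumeration[c [c_surj cE]].
have [r rK] : exists r, cancel r c.
  by have [r ?] := choice c_surj; exists r.
pose act g i := c (g * r i).
have actE g x : act g (c x) = c (g * x).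
  by apply/cE; rewrite invgM -mulgA mulKg; apply/cE; rewrite rK.
exists c, act; split => //.
- by move=> i; rewrite /act mul1g rK.
- by move=> g h i; rewrite -(rK i) !actE mulgA.
- by move=> i j; exists (r j * (r i)^-1); rewrite /act mulgVK rK.
Qed.

(** The cosets used are those of [s ^- i]: [s] lowers the index by one, and [t] fixes such a coset
    exactly when [s ^+ i * t * s ^- i] lies in [H]. *)
Lemma kazhdan_le_of_coset (R : realType) (s t : G) (m : nat) :
  (forall p, (0 < p)%N -> ~ H (s ^+ p)) ->
  (forall i, (i < m.+1)%N -> H (s ^+ i * t * s ^- i)) ->
  (kazhdan R [fset s; t]%fset <= (2 / Num.sqrt m.+1%:R)%:E)%E.
Proof.
move=> sH tH; have [c [act [act1 actM act_trans cE actE]]] := coset_action sH.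
apply: (@kazhdan_le_of_action R G act act1 actM s t (fun i => c (s ^- i))) => //.
- have lt_neq i j : (i < j)%N -> c (s ^- i) <> c (s ^- j).
    move=> ij /cE; rewrite invgK => /HV; rewrite invgM invgK => Hs.
    apply: (sH (j - i)%N); first by rewrite subn_gt0.
    suff -> : s ^+ (j - i) = s ^+ j * s ^- i by [].
    by rewrite -{2}(subnK (ltnW ij)) expgnDr mulgK.
  by move=> i j cij; have [/lt_neq|/lt_neq/nesym|] := ltngtP i j.
- by move=> i; rewrite actE expgSr invgM mulVKg.
- by move=> i /tH Hi; rewrite actE; apply/cE; rewrite -[_^-1]mulg1;
    rewrite -mulgA mul1g -[X in H X]invgK; apply: HV; rewrite invgM !invgK mulgA.
Qed.

End CosetAction.

(** * Ping-pong in SL_n(Z) *)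

Section Elementary.
Variable n : nat.
Implicit Types (i j r s : 'I_n) (c d : int).

Definition elem_mx i j c : 'M[int]_n := (1%:M)%R + c *: delta_mx i j.

Lemma elem_mxE i j c m (A : 'M[int]_(n, m)) r (s : 'I_m) :
  (elem_mx i j c *m A) r s = A r s + (r == i)%:R * c * A j s.
Proof.
rewrite mulmxDl mul1mx -scalemxAl !mxE; congr (_ + _).
rewrite (bigD1 j) //= big1 => [|k kj]; last first.
  by rewrite !mxE (negbTE kj) andbF mul0r.
by rewrite !mxE eqxx andbT addr0 mulrCA mulrA.
Qed.

Lemma det_elem_mx i j c : i != j -> \det (elem_mx i j c) = 1.
Proof.
have trig (i' j' : 'I_n) : (j' < i')%N -> \det (elem_mx i' j' c) = 1.
  move=> ji; rewrite det_trig.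
    rewrite big1 // => k _; rewrite !mxE eqxx; have [->|] := eqVneq k i'.
      by rewrite -val_eqE /= (gtn_eqF ji) mulr0 addr0.
    by rewrite mulr0 addr0.
  apply/is_trig_mxP => r s rs; rewrite !mxE -!val_eqE /= (ltn_eqF rs) add0r.
  case: eqP => [ri|]; rewrite ?mulr0 //=; case: eqP => [sj|]; rewrite ?mulr0 //.
  by move: rs; rewrite ri sj ltnNge (ltnW ji).
move=> ij; have [/trig //|ij'|ij'] := ltngtP j i.
  rewrite -det_tr (_ : (elem_mx i j c)^T = elem_mx j i c); last first.
    by rewrite /elem_mx linearD linearZ /= trmx1 trmx_delta.
  exact: trig.
by rewrite (val_inj ij') eqxx in ij.
Qed.

(** For [i = j] the determinant is [1 + c], and [insubd] falls back to the identity when it differs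
    from 1. *)
Definition elem i j c : SLZ n := insubd (1%g : SLZ n) (elem_mx i j c).

Lemma val_elem i j c : i != j -> val (elem i j c) = elem_mx i j c.
Proof. by move=> ij; rewrite val_insubd det_elem_mx // eqxx. Qed.

Lemma SLZ_valM (A B : SLZ n) : val (A * B)%g = val A *m val B. Proof. by []. Qed.

Lemma SLZ_val1 : val (1%g : SLZ n) = 1%:M. Proof. by []. Qed.

Lemma elemD i j c d : i != j -> (elem i j c * elem i j d)%g = elem i j (c + d).
Proof.
move=> ij; apply/val_inj; rewrite SLZ_valM !val_elem //.
apply/matrixP => r s; rewrite elem_mxE !mxE (eq_sym j i) (negbTE ij) /=.
rewrite (eq_sym j s); case: (r == i) => /=; last by rewrite !mulr0 !mul0r addr0.
by rewrite mulr0 addr0 mul1r -addrA -mulrDl (addrC d).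
Qed.

Lemma elem0 i j : elem i j 0 = 1%g.
Proof.
apply/val_inj; rewrite val_insubd /elem_mx scale0r addr0 det1 eqxx.
exact: SLZ_val1.
Qed.

Lemma elemN i j c : i != j -> elem i j (- c) = (elem i j c)^-1%g.
Proof.
by move=> ij; apply: (mulgI (elem i j c)); rewrite elemD // subrr elem0 mulgV.
Qed.

Lemma elemX i j c k : i != j -> (elem i j c ^+ k)%g = elem i j (c *+ k).
Proof.
move=> ij; elim: k => [|k IHk]; first by rewrite mulr0n elem0.
by rewrite expgS IHk elemD // mulrS.
Qed.

Lemma SLZ_mulKmx m (A : SLZ n) (u : 'M[int]_(n, m)) :
  val A^-1%g *m (val A *m u) = u.
Proof. by rewrite mulmxA -SLZ_valM mulVg SLZ_val1 mul1mx. Qed.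

Lemma SLZ_mulVKmx m (A : SLZ n) (u : 'M[int]_(n, m)) :
  val A *m (val A^-1%g *m u) = u.
Proof. by rewrite mulmxA -SLZ_valM mulgV SLZ_val1 mul1mx. Qed.

Lemma SLZ_inj_code : exists code : SLZ n -> nat, injective code.
Proof.
exists (fun A => choice.pickle (val A)) => A B.
by move=> /(pcan_inj (@choice.pickleK _)) /val_inj.
Qed.

End Elementary.

(** * The companion matrix *)

Section Companion.
Variable n' : nat.
Local Notation n := n'.+3.
Implicit Types (u v w : 'cV[int]_n) (p : int).

(** The index [i] stands for row [i + 1]. The coefficient 10 drives the ping-pong; the coefficient 1
    provides, for [n > 3], the transvection with entry 1 or -1 on which the generation argument
    rests. *)
Definition shift_coef (i : nat) : int := (i == 1%N)%:R * 10 + (i == 2%N)%:R.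

(* The companion matrix sending [e_j] to [e_(j+1)] for [j < n - 1] and the last
   basis vector to [+/- e_0 + 10 e_2 + e_3] (without [e_3] if [n = 3]). *)
Definition companion_mx : 'M[int]_n := \matrix_(i, j)
  if unlift ord0 i is Some k then
    (j == lift ord_max k)%:R + (j == ord_max)%:R * shift_coef k
  else (j == ord_max)%:R * (-1) ^+ n'.

Lemma companion_mx0 m (A : 'M[int]_(n, m)) (s : 'I_m) :
  (companion_mx *m A) ord0 s = (-1) ^+ n' * A ord_max s.
Proof.
rewrite !mxE (bigD1 ord_max) //= big1 ?addr0 => [|k kM].
  by rewrite !mxE unlift_none eqxx mul1r.
by rewrite !mxE unlift_none (negbTE kM) !mul0r.
Qed.

Lemma companion_mxS m (A : 'M[int]_(n, m)) (k : 'I_n'.+2) (s : 'I_m) :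
  (companion_mx *m A) (lift ord0 k) s =
  A (lift ord_max k) s + shift_coef k * A ord_max s.
Proof.
rewrite !mxE (bigD1 ord_max) //= (bigD1 (lift ord_max k)) /=; last first.
  by rewrite eq_sym neq_lift.
rewrite big1 ?addr0 => [|i /andP[iM ik]].
  rewrite !mxE !liftK !eqxx mul1r (negbTE (neq_lift _ _)) add0r.
  by rewrite eq_sym (negbTE (neq_lift _ _)) mul0r addr0 mul1r addrC.
by rewrite !mxE liftK (negbTE iM) (negbTE ik) mul0r addr0 mul0r.
Qed.

(** Row 0 has a single nonzero entry, in the last column, and its minor is the identity; the sign of
    that entry is chosen to offset the cofactor sign. *)
Lemma det_companion_mx : \det companion_mx = 1.
Proof.
rewrite (expand_det_row _ ord0) (bigD1 ord_max) //= big1 ?addr0 => [|k kM].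
  rewrite !mxE unlift_none eqxx mul1r /cofactor.
  rewrite (_ : row' _ _ = 1%:M) ?det1 ?mulr1.
    by rewrite add0n -exprD -signr_odd addnS oddS addnS oddS negbK addnn odd_double.
  apply/matrixP => i j; rewrite !mxE liftK.
  rewrite (inj_eq lift_inj) (eq_sym (lift _ _) ord_max) (negbTE (neq_lift _ _)).
  by rewrite mul0r addr0 eq_sym.
by rewrite !mxE unlift_none (negbTE kM) !mul0r.
Qed.

Definition companion : SLZ n := insubd (1%g : SLZ n) companion_mx.

Lemma val_companion : val companion = companion_mx.
Proof. by rewrite val_insubd det_companion_mx eqxx. Qed.

End Companion.

(** * Ping-pong inequalities for the companion matrix and the transvection *)

Section PingPong.
Variable n' : nat.
Local Notation n := n'.+3.
Local Notation Y := (companion_mx n').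
Local Notation i1 := (lift ord0 ord0 : 'I_n).
Local Notation i2 := (lift ord0 (lift ord0 ord0) : 'I_n).
Local Notation X := (elem_mx (ord0 : 'I_n) i1).
Implicit Types (u v w : 'cV[int]_n) (p : int).

Definition coord u (i : 'I_n) : int := u i 0.

Lemma shift_coef_cases i : [\/ shift_coef i = 0, shift_coef i = 1 | shift_coef i = 10].
Proof.
by case: i => [|[|[|i]]]; rewrite /shift_coef;
  [exact: Or31|exact: Or33|exact: Or32|exact: Or31].
Qed.

Lemma coord_companion0 u : coord (Y *m u) ord0 = (-1) ^+ n' * coord u ord_max.
Proof. exact: companion_mx0. Qed.

Lemma coord_companionS u k : coord (Y *m u) (lift ord0 k) =
  coord u (lift ord_max k) + shift_coef k * coord u ord_max.
Proof. exact: companion_mxS. Qed.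

Lemma coord_companion1 u : coord (Y *m u) i1 = coord u ord0.
Proof.
rewrite coord_companionS mul0r addr0; congr (coord u _); exact/val_inj.
Qed.

Lemma coord_companion2 u : coord (Y *m u) i2 = coord u i1 + 10 * coord u ord_max.
Proof.
rewrite coord_companionS; congr (coord u _ + _); exact/val_inj.
Qed.

Lemma coord_transvection0 p u : coord (X p *m u) ord0 = coord u ord0 + p * coord u i1.
Proof. by rewrite /coord elem_mxE eqxx mul1r. Qed.

Lemma coord_transvectionS p u k : coord (X p *m u) (lift ord0 k) = coord u (lift ord0 k).
Proof. by rewrite /coord elem_mxE eq_sym (negbTE (neq_lift _ _)) !mul0r addr0. Qed.

Definition bounded_by u (c : int) := forall i, `|coord u i| <= c.

(* The ratio of the coordinates [i1] of [u] and [v] drives the ping-pong between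
   opposite powers of the companion matrix; that the coordinate [i1] of [u]
   controls all coordinates of [u] and [v] is what a large power of the
   transvection needs between two equal powers. *)
Definition player_pos u := 1 <= `|coord u i1| /\ exists v, [/\ u = Y *m v,
  bounded_by u (6 * `|coord u i1|), bounded_by v (6 * `|coord u i1|)
  & `|coord v i1| <= 2 * `|coord u i1|].

Definition player_neg u := 4 <= `|coord u i1| /\ exists v, [/\ v = Y *m u,
  bounded_by u (2 * `|coord u i1|), bounded_by v (2 * `|coord u i1|)
  & 2 * `|coord v i1| <= `|coord u i1|].

Let sgn_cases : (-1) ^+ n' = 1 :> int \/ (-1) ^+ n' = -1 :> int.
Proof. by rewrite -signr_odd; case: (odd n'); [right|left]. Qed.

(** Hiding the product [p * coord u i1] behind [x] leaves only linear facts, within the reach of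
    [lia]. *)
Let transvection p u : exists x : int,
  [/\ coord (X p *m u) ord0 = coord u ord0 + x,
      p != 0 -> `|coord u i1| <= `|x|
    & 21 <= `|p| -> 21 * `|coord u i1| <= `|x| ].
Proof.
exists (p * coord u i1); split=> [|p0|p21]; first exact: coord_transvection0.
  by rewrite normrM ler_peMl // -gtz0_ge1 normr_gt0.
by rewrite normrM ler_wpM2r.
Qed.

(** Up to sign, the last coordinate of [w] is that of [v] plus [x], up to the sign of [x]. In
    coordinate [i2] the multiples [10 * coord v ord_max] cancel, so [coord w i1] is [coord v i1]
    plus or minus [10 * x], of size at least [(10 - 2) * |x|]. The other coordinates of [w] are at
    most [(6 + 10) * |x|], whence the factor 2 in [player_neg]. *)
Lemma player_pos_neg u w p : p != 0 -> player_pos u -> Y *m w = X p *m u ->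
  player_neg w /\ 2 <= `|coord w i1|.
Proof.
move=> p0 [b1 [v [uE ub vb v1]]] wE.
have [x [xE /(_ p0) xb _]] := transvection p u.
have u0 := coord_companion0 v; have uS := coord_companionS v.
have u2 := coord_companion2 v; rewrite -uE in u0 uS u2.
have w0 := coord_companion0 w; have w2 := coord_companion2 w.
have wS k := coord_companionS w k.
rewrite wE xE in w0; rewrite wE coord_transvectionS in w2.
have wb : 8 * `|x| <= `|coord w i1|.
  by case: sgn_cases w0 u0 => ->; lia.
split; last by lia.
split; first by lia.
exists (X p *m u); split=> // [i|i|].
- case: (unliftP ord_max i) => [k ->|->].
    have := wS k; rewrite wE coord_transvectionS.
    have := uS k; have := vb (lift ord_max k).
    by case: (shift_coef_cases k) => ->; case: sgn_cases w0 u0 => ->; lia.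
  by have := vb ord_max; case: sgn_cases w0 u0 => ->; lia.
- case: (unliftP ord0 i) => [k ->|->].
    by rewrite coord_transvectionS; have := ub (lift ord0 k); lia.
  by rewrite xE; have := ub ord0; lia.
- by rewrite coord_transvectionS; lia.
Qed.

Let transvection_max p u : coord (X p *m u) ord_max = coord u ord_max.
Proof.
by rewrite (_ : ord_max = lift ord0 ord_max) ?coord_transvectionS //; exact/val_inj.
Qed.

Let transvection_dist p u x : coord (X p *m u) ord0 = coord u ord0 + x ->
  forall i, `|coord (X p *m u) i - coord u i| <= `|x|.
Proof.
move=> xE i; case: (unliftP ord0 i) => [k ->|->]; last by rewrite xE; lia.
by rewrite coord_transvectionS subrr normr0.
Qed.

(** Coordinate [i1] of the image is [coord v i1 + x], where [coord v i1] is at most half of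
    [coord u i1] in size; so its size is at least [|x| / 2], which is at least 2 by the bound 4 in
    [player_neg]. All coordinates differ from those of [v] by at most [|x|], hence are at most
    [3 * |x|], whence the factor 6 in [player_pos]. *)
Lemma player_neg_pos u p : p != 0 -> player_neg u ->
  player_pos (Y *m (X p *m u)) /\ 2 <= `|coord (Y *m (X p *m u)) i1|.
Proof.
move=> p0 [b1 [v [vE ub vb v1]]].
have [x [xE /(_ p0) xb _]] := transvection p u.
have xd := transvection_dist xE.
have v0 := coord_companion0 u; have vS := coord_companionS u.
have v2 := coord_companion1 u; rewrite -vE in v0 vS v2.
have w1 := coord_companion1 (X p *m u); rewrite xE in w1.
have w0 := coord_companion0 (X p *m u); have wS := coord_companionS (X p *m u).
rewrite transvection_max in w0 wS.
set w := Y *m _ in w0 w1 wS *.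
split; last by lia.
split; first by lia.
exists (X p *m u); split=> // [i|i|].
- case: (unliftP ord0 i) => [k ->|->].
    have := vb (lift ord0 k); rewrite wS vS.
    have := xd (lift ord_max k).
    by move: (_ * _) => y; lia.
  by rewrite w0 -v0; have := vb ord0; lia.
- by have := xd i; have := ub i; lia.
- by rewrite coord_transvectionS; lia.
Qed.

(** With [b] the size of [coord u i1], coordinate [i1] of the image has size at least [|x| - 6b],
    and the others at most [|x| + 66b]. The factor 6 of [player_pos] then requires [5|x| >= 102b],
    and 21 is the least integer multiple of [b] that ensures it. *)
Lemma player_pos_pos u p : 21 <= `|p| -> player_pos u ->
  player_pos (Y *m (X p *m u)) /\ 2 <= `|coord (Y *m (X p *m u)) i1|.
Proof.
move=> p21 [b1 [v [_ ub _ _]]].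
have [x [xE _ /(_ p21) xb]] := transvection p u.
have xd := transvection_dist xE.
have w1 := coord_companion1 (X p *m u); rewrite xE in w1.
have w0 := coord_companion0 (X p *m u); have wS := coord_companionS (X p *m u).
rewrite transvection_max in w0 wS.
set w := Y *m _ in w0 w1 wS *.
have ub0 := ub ord0; have ubM := ub ord_max.
split; last by lia.
split; first by lia.
exists (X p *m u); split=> // [i|i|].
- case: (unliftP ord0 i) => [k ->|->].
    rewrite wS; have := xd (lift ord_max k); have := ub (lift ord_max k).
    by case: (shift_coef_cases k) => ->; lia.
  by rewrite w0; case: sgn_cases => ->; lia.
- by have := xd i; have := ub i; lia.
- by rewrite coord_transvectionS; lia.
Qed.

(** Nothing cancels here, but [10 * x] dominates: the error 22 in [wb] is 10 times the bound 2 on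
    [coord u ord0], plus the bound 2 on [coord u i2]. *)
Lemma player_neg_neg u w p : 21 <= `|p| -> player_neg u -> Y *m w = X p *m u ->
  player_neg w /\ 2 <= `|coord w i1|.
Proof.
move=> p21 [b1 [v [_ ub _ _]]] wE.
have [x [xE _ /(_ p21) xb]] := transvection p u.
have xd := transvection_dist xE.
have w0 := coord_companion0 w; have w2 := coord_companion2 w.
have wS k := coord_companionS w k.
rewrite wE xE in w0; rewrite wE coord_transvectionS in w2.
have ub0 := ub ord0; have ub2 := ub i2.
have wb : 10 * `|x| <= `|coord w i1| + 22 * `|coord u i1|.
  by case: sgn_cases w0 => ->; lia.
split; last by lia.
split; first by lia.
exists (X p *m u); split=> // [i|i|].
- case: (unliftP ord_max i) => [k ->|->].
    have := wS k; rewrite wE coord_transvectionS; have := ub (lift ord0 k).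
    by case: (shift_coef_cases k) => ->; case: sgn_cases w0 => ->; lia.
  by case: sgn_cases w0 => ->; lia.
- by have := xd i; have := ub i; lia.
- by rewrite coord_transvectionS; lia.
Qed.

End PingPong.

(** * Reduced words in the conjugates *)

Section Words.
Variables (n' m : nat).
Local Notation n := n'.+3.
Local Notation i1 := (lift ord0 ord0 : 'I_n).
Local Notation x := (elem (ord0 : 'I_n) i1).
Local Notation y := (companion n').
Local Notation k := ((m + 21)%N%:Z).
Implicit Types (u v w : 'cV[int]_n) (p : int) (b : bool) (a : nat * bool).
Implicit Types (l : seq (nat * bool)).

(** With [z = y * x k], the pair [(i, true)] encodes the conjugate of [z] by [x i], and [(i, false)]
    its inverse. *)
Definition letter a : SLZ n :=
  if a.2 then (x a.1%:Z * y * x (k - a.1%:Z))%g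
  else (x (a.1%:Z - k) * y^-1 * x (- a.1%:Z))%g.

Definition letter_inv a := (a.1, ~~ a.2).

Lemma letter_invE a : letter (letter_inv a) = (letter a)^-1%g.
Proof.
have ij : (ord0 : 'I_n) != i1 by rewrite neq_lift.
by case: a => i [] /=; rewrite /letter /= !invgM -!(elemN _ ij) ?invgK ?opprB
  ?opprK ?mulgA.
Qed.

Fixpoint word l : SLZ n := if l is a :: l' then (letter a * word l')%g else 1%g.

Lemma word_cat l1 l2 : word (l1 ++ l2) = (word l1 * word l2)%g.
Proof. by elim: l1 => [|a l1 IH] /=; rewrite ?mul1g // IH mulgA. Qed.

Lemma word_inv l : word (rev (map letter_inv l)) = (word l)^-1%g.
Proof.
elim: l => [|a l IH] /=; first by rewrite invg1.
by rewrite rev_cons -cats1 word_cat /= mulg1 IH letter_invE invgM.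
Qed.

Let no_cancel : rel (nat * bool) := fun a a' => a' != letter_inv a.

Let small l := all (fun a => a.1 <= m)%N l.

Lemma reduced_word l : small l ->
  exists l', [/\ small l', sorted no_cancel l' & word l' = word l].
Proof.
elim: l => [_|a l IH /= /andP[am /IH[l' [sl' rl' wl']]]]; first by exists [::].
case: l' => [|b l'] in sl' rl' wl' *.
  by exists [:: a]; rewrite /= am -wl'.
have [bE|ba] := eqVneq b (letter_inv a).
  exists l'; split; first by case/andP: sl'.
    exact: path_sorted rl'.
  by rewrite -wl' /= bE letter_invE mulVKg.
exists [:: a, b & l']; split; rewrite /= -?wl' //; apply/andP; split=> //.
Qed.

(** The subgroup [H] of the overview, which is the stabilizer of its own coset. *)
Definition stabilizer : set (SLZ n) := [set g | exists2 l, small l & g = word l].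

Lemma stabilizer1 : stabilizer 1%g. Proof. by exists [::]. Qed.

Lemma stabilizerM g h : stabilizer g -> stabilizer h -> stabilizer (g * h)%g.
Proof.
move=> [l sl ->] [l' sl' ->]; exists (l ++ l'); last by rewrite word_cat.
by rewrite /small all_cat; apply/andP.
Qed.

Lemma stabilizerV g : stabilizer g -> stabilizer g^-1%g.
Proof.
move=> [l sl ->]; exists (rev (map letter_inv l)); last by rewrite word_inv.
by rewrite /small all_rev all_map.
Qed.

Definition player b u := if b then player_pos u else player_neg u.

Lemma player_step b b' p u : (if b == b' then 21 <= `|p| else p != 0) ->
  player b u ->
  let w := val (if b' then y else y^-1)%g *m (val (x p) *m u) in
  player b' w /\ 2 <= `|coord w i1|.
Proof.
rewrite val_elem ?neq_lift //; case: b b' => [] [] /= pP ub.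
- by rewrite val_companion; exact: player_pos_pos.
- apply: player_pos_neg pP ub _; rewrite -val_companion; exact: SLZ_mulVKmx.
- by rewrite val_companion; exact: player_neg_pos.
- apply: player_neg_neg pP ub _; rewrite -val_companion; exact: SLZ_mulVKmx.
Qed.

(** The exponent of [x] at the left end of a letter; by inversion, the one at the right end is minus
    the offset of the inverse letter. *)
Let offset a : int := if a.2 then a.1%:Z else a.1%:Z - k.

Let ij : (ord0 : 'I_n) != i1. Proof. by rewrite neq_lift. Qed.

Let valxD p q u : val (x p) *m (val (x q) *m u) = val (x (p + q)) *m u.
Proof. by rewrite mulmxA -SLZ_valM elemD. Qed.

Lemma coordx p u : coord (val (x p) *m u) i1 = coord u i1.
Proof. by rewrite val_elem // coord_transvectionS. Qed.

Let letterE a : letter a = (x (offset a) * (if a.2 then y else y^-1) *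
  x (- offset (letter_inv a)))%g.
Proof. by case: a => i []; rewrite /letter /offset /= ?opprB. Qed.

(* Every letter is [x^c y^(+/-1) x^d], so only the exponents of [x] between two
   occurrences of [y] matter: a small nonzero one between opposite powers of
   [y], and one close to [+/- k] between equal powers. *)
Lemma letter_step b a c u :
  (if b == a.2 then 21 <= `|c - offset (letter_inv a)|
   else c != offset (letter_inv a)) ->
  player b u -> exists w, [/\ player a.2 w, 2 <= `|coord w i1| &
    val (letter a) *m (val (x c) *m u) = val (x (offset a)) *m w].
Proof.
move=> cP bu.
have cP' : if b == a.2 then 21 <= `|c - offset (letter_inv a)|
    else c - offset (letter_inv a) != 0 by rewrite subr_eq0.
have [pw w2] := player_step cP' bu.
eexists; split; [exact: pw | exact: w2 |].
by rewrite letterE !SLZ_valM -!mulmxA valxD addrC.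
Qed.

Let e1 : 'cV[int]_n := delta_mx i1 0.
(** The exponent [m + 1] exceeds every index [i <= m], so any letter can act first on this vector
    with [e1] as a positive player. *)
Let u0 := val (x m.+1%:Z) *m e1.

Lemma player_e1 : player true e1.
Proof.
have e1i i : coord e1 i = (i == i1)%:R by rewrite /coord mxE andbT.
have e1b c : 1 <= c -> bounded_by e1 c.
  by move=> c1 i; rewrite e1i; case: eqP => _ /=; lia.
split; rewrite e1i eqxx //; exists (delta_mx ord0 0).
have e0i i : coord (delta_mx ord0 0) i = (i == ord0 :> 'I_n)%:R.
  by rewrite /coord mxE andbT.
split=> //.
- apply/matrixP => i j; rewrite [j]ord1 -[LHS]/(coord _ i) -[RHS]/(coord _ i).
  rewrite e1i; case: (unliftP ord0 i) => [r ->|->].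
    rewrite coord_companionS !e0i (inj_eq lift_inj) mulr0 addr0.
    have -> // : (lift ord_max r == ord0 :> 'I_n) = (r == ord0).
    by rewrite -!(inj_eq val_inj) /= [bump _ _]lift_max.
  by rewrite coord_companion0 e0i mulr0.
- by apply: e1b.
- by move=> i; rewrite e0i; case: eqP.
- by rewrite e0i.
Qed.

Lemma word_player l : small l -> sorted no_cancel l -> l != [::] ->
  2 <= `|coord (val (word l) *m u0) i1|.
Proof.
move=> sl rl l0.
(* The player is kept apart from the leftmost power of [x], which merges with the right end of the
   next letter. *)
suff : exists w, [/\ player (head (0, true) l).2 w, 2 <= `|coord w i1| &
    val (word l) *m u0 = val (x (offset (head (0, true) l))) *m w].
  by move=> [w [_ w2 ->]]; rewrite coordx.
elim: l sl rl l0 => [//|a [|b l] IH] /andP[am sl] rl _.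
  rewrite [word _]mulg1; apply: (letter_step _ player_e1).
  by move: am; case: (a) => i [] /= im; rewrite /offset /=; lia.
have [//|w [bw _ wE]] := IH sl (path_sorted rl).
rewrite [word _]/(letter a * word (b :: l))%g SLZ_valM -mulmxA wE.
apply: letter_step bw.
(* Between equal signs the exponent is [j - i] plus or minus [k], of size at least [k - m = 21];
   between opposite signs it is [j - i], nonzero since the word is reduced. *)
move: am sl rl => /= am /andP[bm _] /andP[ba _]; move: am bm ba.
case: (a) (b) => i [] [j []] /=; rewrite /offset /no_cancel /letter_inv xpair_eqE /=;
 rewrite ?andbT ?andbF; lia.
Qed.

(** Powers of [x] keep coordinate [i1] of [u0] equal to 1, whereas a nonempty reduced word makes it
    at least 2 in size. *)
Lemma stabilizer_expg (p : nat) : (0 < p)%N -> ~ stabilizer (x 1 ^+ p)%g.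
Proof.
move=> p0 [l0 /reduced_word[l [sl rl <-]]] xl.
have [l0'|/(word_player sl rl)] := eqVneq l [::].
  have := congr1 (fun g : SLZ n => coord (val g *m e1) ord0) xl.
  rewrite l0' /= elemX // val_elem // coord_transvection0 mul1mx /coord !mxE /=.
  by rewrite add0r mulr1 => /eqP; rewrite pnatr_eq0 eqn0Ngt p0.
rewrite -xl elemX // /u0 valxD coordx /coord mxE eqxx /=; lia.
Qed.

Lemma stabilizer_conj i : (i < m.+1)%N ->
  stabilizer (x 1 ^+ i * (y * x k) * x 1 ^- i)%g.
Proof.
move=> im; exists [:: (i, true)]; first by rewrite /small /= andbT.
rewrite [word _]mulg1 -[letter _]/(x i%:Z * y * x (k - i%:Z))%g.
by rewrite !elemX // natz -elemN // -!mulgA elemD.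
Qed.

Lemma SLZ_kazhdan_le (R : realType) :
  (kazhdan R [fset x 1; (y * x k)%g]%fset <= (2 / Num.sqrt m.+1%:R)%:E)%E.
Proof.
have [code code_inj] := SLZ_inj_code n.
by apply: (kazhdan_le_of_coset code_inj stabilizer1 stabilizerM stabilizerV);
  [exact: stabilizer_expg | exact: stabilizer_conj].
Qed.

End Words.

(** * Generation of SL_n(Z) *)

Section ElementaryGeneration.
Variables (n : nat) (A : set (SLZ n)).
Hypotheses (A1 : A 1%g) (AM : forall g h, A g -> A h -> A (g * h)%g).
Hypothesis (AV : forall g, A g -> A g^-1%g).
Hypothesis A_elem : forall i j c, i != j -> A (elem i j c).
Implicit Types (g : SLZ n) (i j r s : 'I_n) (c d : int) (k : nat).

Let row_op i j c g : i != j -> A (elem i j c * g)%g -> A g.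
Proof.
move=> ij Ag; rewrite -(mulKg (elem i j c) g).
by apply: AM Ag; apply: AV; exact: A_elem.
Qed.

Let entry g i j : int := val g i j.

Let entry_row_op i j c g r s : i != j ->
  entry (elem i j c * g)%g r s = entry g r s + (r == i)%:R * c * entry g j s.
Proof. by move=> ij; rewrite /entry SLZ_valM val_elem // elem_mxE. Qed.

Let reduced_upto k g := forall r s, (s < k)%N -> entry g r s = (r == s)%:R.

Let reduced_row_op k g i j c : i != j -> (k <= j)%N -> reduced_upto k g ->
  reduced_upto k (elem i j c * g)%g.
Proof.
move=> ij kj gk r s sk; rewrite entry_row_op // !gk //.
suff /negbTE -> : j != s by rewrite mulr0 addr0.
by rewrite -val_eqE /= gtn_eqF // (leq_trans sk).
Qed.

(* [v := e_s - sum_(i < s) (g i s) e_i] is mapped by [g] to [(g r s) e_r], so the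
   [s]-th coordinate of [v] gives [1 = (g^-1 s r) (g r s)]. *)
Let entry_unit g r s : reduced_upto s g ->
  (forall i, (s <= i)%N -> i != r -> entry g i s = 0) -> (s <= r)%N ->
  (entry g r s == 1) || (entry g r s == -1).
Proof.
move=> gs g0 sr.
pose v : 'cV[int]_n := \col_j ((j == s)%:R - (j < s)%:R * entry g j s).
have gv : val g *m v = entry g r s *: delta_mx r 0.
  apply/matrixP => i j; rewrite !mxE [j]ord1 eqxx andbT.
  under eq_bigr => p _ do rewrite !mxE mulrBr.
  rewrite sumrB (bigD1 s) //= eqxx mulr1 big1 ?addr0 => [|p /negbTE ->]; last first.
    by rewrite mulr0.
  rewrite -/(entry g i s); have [is_|si] := ltnP i s.
    rewrite (bigD1 i) //= is_ mul1r big1 => [|p pi].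
      rewrite -/(entry g i i) (gs i i is_) eqxx mul1r addr0 subrr.
      by rewrite -val_eqE /= ltn_eqF ?mulr0 // (leq_trans is_).
    have [ps|] := ltnP p s; last by rewrite mul0r mulr0.
    by rewrite -/(entry g i p) (gs i p ps) eq_sym (negbTE pi) mul0r.
  rewrite big1 ?subr0 => [|p _].
    by have [->|/(g0 _ si) ->] := eqVneq i r; rewrite ?mulr1 ?mulr0.
  have [ps|] := ltnP p s; last by rewrite mul0r mulr0.
  rewrite -/(entry g i p) (gs i p ps) -val_eqE /= gtn_eqF ?mul0r //.
  exact: leq_trans ps si.
have := congr1 (fun u => (val g^-1%g *m u) s 0) gv.
rewrite SLZ_mulKmx -scalemxAr !mxE eqxx ltnn mul0r subr0 => e1.
have := congr1 absz e1; rewrite abszM => /esym/eqP; rewrite muln_eq1 => /andP[/eqP r1 _].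
by move: (entry g r s) r1 => z z1; lia.
Qed.

Let SLZ_reduced g : reduced_upto n g -> A g.
Proof.
move=> gn; suff -> : g = 1%g by [].
by apply/val_inj/matrixP => i j; rewrite -[LHS]/(entry g i j) gn // SLZ_val1 mxE.
Qed.

Section Column.
Variable s : 'I_n.
Hypothesis IH : forall g, reduced_upto s.+1 g -> A g.

(** The rows above [s] are cleared from the bottom up with the pivot 1 of row [s]. *)
Let clear_above g : reduced_upto s g ->
  (forall i, (s <= i)%N -> entry g i s = (i == s)%:R) -> A g.
Proof.
suff C p : (p <= s)%N -> forall g', reduced_upto s g' ->
    (forall i, (p <= i)%N -> entry g' i s = (i == s)%:R) -> A g'.
  exact: C.
elim: p => [_|p IHp ps] {}g gs gp.
  apply: IH => i j; rewrite ltnS leq_eqVlt => /predU1P[|]; last exact: gs.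
  by move=> /val_inj ->; exact: gp.
pose i := Ordinal (ltn_trans ps (ltn_ord s)).
have is_ : i != s by rewrite -val_eqE /= ltn_eqF.
apply: (row_op (c := - entry g i s) is_); apply: (IHp (ltnW ps)).
  exact: reduced_row_op.
move=> r; rewrite leq_eqVlt entry_row_op // (gp s ps) eqxx mulr1.
have [-> _|ri] := eqVneq r i; first by rewrite mul1r subrr (negbTE is_).
rewrite mul0r addr0 => /predU1P[pr|]; last exact: gp.
by case/eqP: ri; apply/val_inj.
Qed.

Let single_entry g r : reduced_upto s g -> (s <= r)%N ->
  (forall i, (s <= i)%N -> i != r -> entry g i s = 0) -> A g.
Proof.
move=> gs sr g0; have gr := entry_unit gs g0 sr.
have swap (h : SLZ n) (p : 'I_n) : (s <= p)%N -> p != s -> reduced_upto s h ->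
    (forall i, (s <= i)%N -> i != p -> i != s -> entry h i s = 0) ->
    entry h s s = 1 -> A h.
  move=> sp ps hs h0 h1.
  apply: (row_op (c := - entry h p s) ps); apply: clear_above.
    exact: reduced_row_op.
  move=> i si; rewrite entry_row_op // h1 mulr1.
  have [->|ip] := eqVneq i p; first by rewrite mul1r subrr (negbTE ps).
  rewrite mul0r addr0; have [->|is_] := eqVneq i s; first by rewrite h1.
  exact: h0.
(* Off the diagonal, the entry is its own inverse: adding that multiple of row [r] to row [s]
   creates the pivot 1. *)
have [rs|rs] := eqVneq r s; last first.
  have sr' : s != r by rewrite eq_sym.
  apply: (row_op (c := entry g r s) sr'); apply: (swap _ r) => //.
  - exact: reduced_row_op.
  - by move=> i si ir is_; rewrite entry_row_op // (negbTE is_) !mul0r addr0 g0.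
  - rewrite entry_row_op // eqxx mul1r g0 // add0r.
    by case/orP: gr => /eqP ->.
rewrite rs in gr g0 sr; case/orP: gr => /eqP gr.
  by apply: clear_above => // i si; have [->|is_] := eqVneq i s; rewrite ?gr ?g0.
(* For a pivot -1, two row operations turn the entries [(-1, 0)] in rows [s] and [p] into [(-1, 1)],
   then [(1, 1)]. If [s] is the last row, the matrix is triangular of determinant -1. *)
have [[p sp ps]|last_s] := pselect (exists2 p : 'I_n, (s <= p)%N & p != s).
  have sp' : s != p by rewrite eq_sym.
  apply: (row_op (c := -1) ps); apply: (row_op (c := 2) sp').
  apply: (swap _ p) => //.
  - by apply: reduced_row_op => //; exact: reduced_row_op.
  - move=> i si ip is_; rewrite !entry_row_op // (negbTE is_) (negbTE ip).
    by rewrite !mul0r !addr0 g0.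
  - rewrite !entry_row_op // !eqxx (negbTE sp') gr (g0 p) //.
suff : \det (val g) = -1 by rewrite SLZ_detE.
have lastE i : i != s -> (i < s)%N.
  move=> is_; rewrite ltnNge; apply/negP => si; apply: last_s; exists i => //.
rewrite -det_tr det_trig.
  rewrite (bigD1 s) //= mxE -/(entry g s s) gr big1 ?mulr1 // => i /lastE is_.
  by rewrite mxE -/(entry g i i) gs // eqxx.
apply/is_trig_mxP => i j ij; rewrite mxE -/(entry g j i) gs.
  by rewrite -val_eqE /= gtn_eqF.
apply: (lastE _); apply: contraTneq ij => ->; rewrite -leqNgt.
by have [->//|/lastE/ltnW] := eqVneq j s.
Qed.

(** Subtractive Euclidean algorithm: of two nonzero entries, the smaller is added to or subtracted
    from the larger, and the sum of absolute values decreases until at most one is left. *)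
Let euclid N g : reduced_upto s g ->
  (\sum_(i < n | (s <= i)%N) `|entry g i s| <= N)%N -> A g.
Proof.
elim: N g => [|N IHN] g gs gN.
  have g0 i : (s <= i)%N -> entry g i s = 0.
    move=> si; move: gN; rewrite leqn0 sum_nat_eq0 => /forallP/(_ i).
    by rewrite si absz_eq0 => /eqP.
  by apply: (single_entry gs (leqnn s)) => i si _; exact: g0.
have [[i [j [si sj ij i0 ji]]]|no_pair] := pselect (exists i j,
  [/\ (s <= i)%N, (s <= j)%N, i != j, entry g i s != 0 &
      (`|entry g i s| <= `|entry g j s|)%N]).
  have ji' : j != i by rewrite eq_sym.
  pose c : int := if (0 <= entry g i s) == (0 <= entry g j s) then -1 else 1.
  apply: (row_op (c := c) ji'); apply: IHN; first exact: reduced_row_op.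
  rewrite -ltnS; apply: leq_trans gN; rewrite (bigD1 j) //= [ltnRHS](bigD1 j) //=.
  rewrite -addSn; apply: leq_add.
    rewrite entry_row_op // eqxx mul1r /c.
    move: (entry g i s) (entry g j s) i0 ji => a b a0 ab.
    by case: ifP; case: (lerP 0 a); case: (lerP 0 b) => //=; lia.
  apply: leq_sum => p /andP[_ pj].
  by rewrite entry_row_op // (negbTE pj) !mul0r addr0.
have [[r sr r0]|all0] := pselect (exists2 r : 'I_n, (s <= r)%N & entry g r s != 0).
  apply: (single_entry gs sr) => i si ir; apply/eqP; apply: contrapT => /negP i0.
  apply: no_pair; case: (leqP `|entry g i s| `|entry g r s|) => le_ir.
    by exists i, r.
  by exists r, i; split=> //; [rewrite eq_sym|exact: ltnW].
apply: (single_entry gs (leqnn s)) => i si _; apply/eqP; apply: contrapT => /negP i0.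
by apply: all0; exists i.
Qed.

Lemma reduced_column g : reduced_upto s g -> A g.
Proof. by move=> gs; exact: euclid gs (leqnn _). Qed.

End Column.

Lemma SLZ_elementary g : A g.
Proof.
suff R (d : nat) : (d <= n)%N -> forall h, reduced_upto (n - d) h -> A h.
  by apply: (R n (leqnn n)) => i j; rewrite subnn.
elim: d => [_ h|d IHd dn h hd]; first by rewrite subn0; exact: SLZ_reduced.
have sn : (n - d.+1 < n)%N by rewrite ltn_subrL /= (leq_trans _ dn).
apply: (@reduced_column (Ordinal sn)) hd => h' /=.
by rewrite -subSn // subSS => hd; exact: IHd (ltnW dn) _ hd.
Qed.

End ElementaryGeneration.

Section ElementaryRelations.
Variable n : nat.
Implicit Types (i j k l : 'I_n) (c d : int).

Lemma elem_comm i j k l c d : i != j -> k != l -> j != k -> i != l ->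
  (elem i j c * elem k l d)%g = (elem k l d * elem i j c)%g.
Proof.
move=> ij kl jk il; apply/val_inj; rewrite !SLZ_valM !val_elem // /elem_mx.
rewrite !mulmxDl !mulmxDr !mul1mx !mulmx1 -!scalemxAl -!scalemxAr.
rewrite !mul_delta_mx_0 // 1?eq_sym // !scaler0 !addr0.
by rewrite -!addrA [in LHS](addrC (_ *: _)).
Qed.

Lemma elem_swap i j k c d : i != j -> j != k -> i != k ->
  (elem i j c * elem j k d)%g =
  (elem i k (c * d) * elem j k d * elem i j c)%g.
Proof.
move=> ij jk ik; apply/val_inj; rewrite !SLZ_valM !val_elem //.
rewrite -[LHS]mulmx1 -[RHS]mulmx1 -!mulmxA; apply/matrixP => r s.
rewrite !elem_mxE eqxx (eq_sym k i) (eq_sym k j) (negbTE ik) (negbTE jk) /=.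
by ring.
Qed.

End ElementaryRelations.

(** * Generation by the transvection and the companion matrix *)

Section CompanionGeneration.
Variables (n' : nat) (A : set (SLZ n'.+3)).
Local Notation n := n'.+3.
Hypotheses (A1 : A 1%g) (AM : forall g h, A g -> A h -> A (g * h)%g).
Hypothesis (AV : forall g, A g -> A g^-1%g).
Local Notation i1 := (lift ord0 ord0 : 'I_n).
Local Notation y := (companion n').
Hypothesis A_x : forall c, A (elem ord0 i1 c).
Hypothesis A_y : A y.
Implicit Types (a b : 'I_n'.+2) (i j k : 'I_n) (c d : int).

Lemma companion_mul_elem i j c r s : i != j ->
  (companion_mx n' *m elem_mx i j c) r s =
  companion_mx n' r s + c * companion_mx n' r i * (j == s)%:R.
Proof.
move=> ij; rewrite /elem_mx mulmxDr mulmx1 -scalemxAr !mxE; congr (_ + _).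
rewrite (bigD1 i) //= big1 => [|p pa].
  by rewrite !mxE eqxx addr0 (eq_sym s) mulrA.
by rewrite !mxE (negbTE pa) mulr0.
Qed.

Lemma companion_mx_col r a :
  companion_mx n' r (lift ord_max a) = (r == lift ord0 a)%:R.
Proof.
have aM : (lift ord_max a == ord_max :> 'I_n) = false.
  by rewrite eq_sym (negbTE (neq_lift _ _)).
case: (unliftP ord0 r) => [p ->|->]; rewrite !mxE.
  by rewrite liftK !(inj_eq lift_inj) aM mul0r addr0 eq_sym.
by rewrite unlift_none aM mul0r (negbTE (neq_lift _ _)).
Qed.

(** The matrix [y] sends basis vector [a] to [a + 1], and [y^-1] pulls coordinate form [b] back to
    form [b + 1] minus a signed [shift_coef b] times form 0. *)
Lemma companion_conj a b c : a != b ->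
  (y * elem (lift ord_max a) (lift ord_max b) c)%g =
  (elem (lift ord0 a) (lift ord0 b) c *
   elem (lift ord0 a) ord0 (- (c * shift_coef b * (-1) ^+ n')) * y)%g.
Proof.
move=> ab; have ab' (i : 'I_n) : lift i a != lift i b by rewrite (inj_eq lift_inj).
have a0 : lift ord0 a != ord0 :> 'I_n by rewrite eq_sym neq_lift.
apply/val_inj; rewrite -mulgA !SLZ_valM !val_elem // val_companion.
apply/matrixP => r s; rewrite companion_mul_elem // companion_mx_col.
rewrite !elem_mxE !(inj_eq lift_inj) (eq_sym b) (negbTE ab) /=.
have YE (t : 'I_n) (p : 'I_n'.+2) : companion_mx n' (lift ord0 p) t =
    (t == lift ord_max p)%:R + (t == ord_max)%:R * shift_coef p.
  by rewrite !mxE liftK.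
have Y0 (t : 'I_n) : companion_mx n' ord0 t = (t == ord_max)%:R * (-1) ^+ n'.
  by rewrite !mxE unlift_none.
have s2 : (-1) ^+ n' * (-1) ^+ n' = 1 :> int by rewrite -expr2 sqrr_sign.
rewrite YE Y0 (eq_sym (lift ord_max b)).
move: ((-1) ^+ n' : int) s2 => e s2; case: (r == _); rewrite /= ?mul0r ?mul1r ?addr0.
  move: ((s == ord_max)%:R : int) ((s == lift ord_max b)%:R : int) => q' q.
  have -> : - (c * shift_coef b * e) * (q' * e) = - (c * shift_coef b * q') * (e * e).
    by ring.
  by rewrite s2; ring.
by rewrite mulr0 mul0r addr0.
Qed.

Lemma companion_conj_max a c :
  (y * elem (lift ord_max a) ord_max c)%g =
  (elem (lift ord0 a) ord0 (c * (-1) ^+ n') * y)%g.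
Proof.
have aM : lift ord_max a != ord_max :> 'I_n by rewrite eq_sym neq_lift.
have a0 : lift ord0 a != ord0 :> 'I_n by rewrite eq_sym neq_lift.
apply/val_inj; rewrite !SLZ_valM !val_elem // val_companion.
apply/matrixP => r s; rewrite companion_mul_elem // elem_mxE companion_mx_col.
rewrite [companion_mx n' ord0 s]mxE unlift_none.
have s2 : (-1) ^+ n' * (-1) ^+ n' = 1 :> int by rewrite -expr2 sqrr_sign.
rewrite (eq_sym ord_max); move: ((-1) ^+ n' : int) s2 => e s2.
move: ((r == _)%:R : int) ((s == _)%:R : int) => q q'; congr (_ + _).
have -> : q * (c * e) * (q' * e) = q * c * q' * (e * e) by ring.
by rewrite s2; ring.
Qed.

Let conjA g h : (y * g)%g = (h * y)%g -> A g <-> A h.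
Proof.
move=> E; have -> : h = (y * g * y^-1)%g by rewrite E mulgK.
split=> [Ag|Ah]; first by apply: AM; [exact: AM|exact: AV].
have -> : g = (y^-1 * (y * g * y^-1) * y)%g by rewrite !mulgA mulVg mul1g mulgVK.
by apply: AM => //; apply: AM => //; exact: AV.
Qed.

Let cancelAr g h : A g -> A (h * g)%g -> A h.
Proof. by move=> Ag Ahg; rewrite -(mulgK g h); apply: AM => //; exact: AV. Qed.

Let comm_elem i j k c : i != j -> j != k -> i != k ->
  (forall d, A (elem i j d)) -> (forall d, A (elem j k d)) -> A (elem i k c).
Proof.
move=> ij jk ik Aij Ajk; have := elem_swap c 1 ij jk ik; rewrite mulr1 => E.
have : A (elem i k c * elem j k 1 * elem i j c)%g by rewrite -E; exact: AM.
by move=> /(cancelAr (Aij c)) /(cancelAr (Ajk 1)).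
Qed.

Local Notation a1 := (lift ord0 ord0 : 'I_n'.+2).
Local Notation i2 := (lift ord0 a1 : 'I_n).

Let pre0 : lift ord_max (ord0 : 'I_n'.+2) = ord0 :> 'I_n.
Proof. exact/val_inj. Qed.

Let pre1 : lift ord_max a1 = i1. Proof. exact/val_inj. Qed.

Let conj_e10 c : (y * elem i1 ord0 c)%g = (elem i2 i1 c * y)%g.
Proof.
have := @companion_conj a1 ord0 c isT; rewrite pre0 pre1 => ->.
by rewrite mulr0 mul0r oppr0 elem0 mulg1.
Qed.

(** If [n = 3], index 2 is the last one and [w] is trivial; otherwise [w] is a transvection in
    position (2, 3), and the coefficient 1 of [shift_coef] gives [s]. *)
Let conj_e12 : exists (w : SLZ n) (s : int), [/\ s * s = 1,
  (y * elem i1 i2 1)%g = (w * elem i2 ord0 s * y)%g,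
  forall c, (w * elem ord0 i1 c)%g = (elem ord0 i1 c * w)%g
  & forall c, (w * elem i2 i1 c)%g = (elem i2 i1 c * w)%g].
Proof.
have sgn2 : (-1) ^+ n' * (-1) ^+ n' = 1 :> int by rewrite -expr2 sqrr_sign.
have [n0|n0] := posnP n'.
  have i2E : i2 = ord_max by apply/val_inj; rewrite /= n0.
  exists 1%g, ((-1) ^+ n'); split=> // [|c|c]; rewrite ?mul1g ?mulg1 //.
  by have := companion_conj_max a1 1; rewrite pre1 mul1r -i2E.
have n2 : (2 < n'.+2)%N by rewrite !ltnS.
pose a2 : 'I_n'.+2 := Ordinal n2.
have pre2 : lift ord_max a2 = i2 by apply/val_inj; exact: lift_max.
have a12 : a1 != a2 by [].
exists (elem i2 (lift ord0 a2) 1), (- (1 * 1 * (-1) ^+ n')).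
split.
- by rewrite !mul1r mulrNN.
- by have := @companion_conj a1 a2 1 a12; rewrite pre1 pre2.
- by move=> c; apply: elem_comm.
- by move=> c; apply: elem_comm.
Qed.

(* Conjugating [x] twice by [y] gives a transvection [1 + e_2 psi] with
   [psi_0 = +/- 1] and [psi_2 = 0]; its commutator with [x] is [E_21(+/- 1)]. *)
Let A_e21 c : A (elem i2 i1 c).
Proof.
have [w [s [s2 E wx we]]] := conj_e12.
pose d : int := - (1 * shift_coef a1 * (-1) ^+ n').
pose b := (w * elem i2 ord0 s * elem i2 i1 d)%g.
have A_b : A b.
  apply/(@conjA (elem i1 i2 1 * elem i1 ord0 d)%g).
    by rewrite mulgA E -mulgA conj_e10 /b !mulgA.
  apply/(conjA _ : A (elem ord0 i1 1) <-> _); last exact: A_x.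
  by have := @companion_conj ord0 a1 1 isT; rewrite pre0 pre1.
have bx : (b * elem ord0 i1 (s * c) = elem i2 i1 c * elem ord0 i1 (s * c) * b)%g.
  have hd : (elem i2 i1 d * elem ord0 i1 (s * c) =
             elem ord0 i1 (s * c) * elem i2 i1 d)%g by exact: elem_comm.
  have hs : (elem i2 ord0 s * elem ord0 i1 (s * c) =
             elem i2 i1 c * elem ord0 i1 (s * c) * elem i2 ord0 s)%g.
    by rewrite (@elem_swap _ i2 ord0 i1) // mulrA s2 mul1r.
  have {wx} hx := wx (s * c); have {we} he := we c.
  rewrite /b; move: hd hs hx he.
  move: (elem i2 i1 d) (elem ord0 i1 _) (elem i2 ord0 s) (elem i2 i1 c).
  move=> e f h p hd hs hx he.
  by rewrite -(mulgA _ e) hd (mulgA _ f) -(mulgA w) hs !mulgA he -(mulgA p) hx !mulgA.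
apply: (cancelAr (A_x (s * c))).
rewrite -(mulgK b (_ * _)%g) -bx.
by apply: AM; [exact: AM|exact: AV].
Qed.

Let A_e10 c : A (elem i1 ord0 c).
Proof. by apply/(conjA (conj_e10 c)). Qed.

(** To reach the new index [k + 2], conjugation by [y] carries positions [(k + 1, 0)] and
    [(0, k + 1)] to [(k + 2, 1)] and [(1, k + 2)], the latter up to position [(1, 0)]; commutators
    through index 1 give the rest. *)
Let A_block (k : nat) : (k.+1 < n)%N -> forall i j c, i != j -> (i <= k.+1)%N ->
  (j <= k.+1)%N -> A (elem i j c).
Proof.
have ord01 (i : 'I_n) : (i <= 1)%N -> i = ord0 \/ i = i1.
  by case: i => [[|[|i]]] // ?; [left|right]; exact/val_inj.
elim: k => [|k IHk kn].
  move=> _ i j c ij /ord01[] iE /ord01[] jE; move: ij; rewrite iE jE ?eqxx //.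
have r2 : (k.+1 < n'.+2)%N by [].
pose a : 'I_n'.+2 := Ordinal r2.
have aE : nat_of_ord (lift ord_max a) = k.+1 by exact: lift_max.
have suE : nat_of_ord (lift ord0 a) = k.+2 by [].
have {}IHk := IHk (ltnW kn).
have pre_a0 : lift ord_max a != ord0 by apply/eqP => E; move: aE; rewrite E.
have sa1 : lift ord0 a != i1 by [].
have A_r1 c : A (elem (lift ord0 a) i1 c).
  have := @companion_conj a ord0 c isT.
  rewrite pre0 mulr0 mul0r oppr0 elem0 mulg1 => /conjA <-.
  by apply: IHk; rewrite ?aE.
have A_1r c : A (elem i1 (lift ord0 a) c).
  have := @companion_conj ord0 a c isT; rewrite pre0 => /conjA E.
  apply: cancelAr (proj1 E _); first exact: A_e10.
  by apply: IHk; rewrite ?aE // eq_sym.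
have A_rj j c : (j <= k.+1)%N -> A (elem (lift ord0 a) j c).
  move=> jk; have [->//|j1] := eqVneq j i1.
  have rj : lift ord0 a != j by rewrite -val_eqE /= gtn_eqF // ltnS.
  apply: (comm_elem (j := i1)) => //; first by rewrite eq_sym.
  by move=> d; apply: IHk => //; rewrite eq_sym.
have A_jr j c : (j <= k.+1)%N -> A (elem j (lift ord0 a) c).
  move=> jk; have [->//|j1] := eqVneq j i1.
  have rj : j != lift ord0 a by rewrite -val_eqE /= ltn_eqF // ltnS.
  by apply: (comm_elem (j := i1)) => // d; apply: IHk.
move=> i j c ij; rewrite leq_eqVlt => /predU1P[ir|]; last (rewrite ltnS => ik);
  rewrite leq_eqVlt => /predU1P[jr|]; last (rewrite ltnS => jk).
- by case/eqP: ij; apply: ord_inj; rewrite ir jr.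
- by rewrite (_ : i = lift ord0 a); [exact: A_rj|exact/val_inj].
- by rewrite (_ : j = lift ord0 a); [exact: A_jr|exact/val_inj].
- exact: IHk.
Qed.

Lemma companion_generation g : A g.
Proof.
apply: SLZ_elementary => // i j c ij.
by apply: (A_block (k := n'.+1)) => //; rewrite -ltnS ltn_ord.
Qed.

End CompanionGeneration.

Lemma companion_generates (n' m : nat) :
  generates [fset elem ord0 (lift ord0 ord0) 1;
    (companion n' * elem ord0 (lift ord0 ord0) (m + 21)%N%:Z)%g]%fset.
Proof.
apply/seteqP; split=> // g _ A [A_group A_S].
have ij : (ord0 : 'I_n'.+3) != lift ord0 ord0 by rewrite neq_lift.
have AM h h' : A h -> A h' -> A (h * h')%g.
  by move=> Ah Ah'; apply/set_mem; apply: (group_closedM A_group); exact/mem_set.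
have AV h : A h -> A h^-1%g.
  by move=> Ah; apply/set_mem; apply: (group_closedV A_group); exact/mem_set.
have A1 : A 1%g by apply/set_mem; case: A_group.
have AX h p : A h -> A (h ^+ p)%g.
  by move=> Ah; elim: p => [|p IHp]; rewrite ?expg0 // expgS; exact: AM.
have A_x1 : A (elem ord0 (lift ord0 ord0) 1).
  by apply: A_S; rewrite /= !inE eqxx.
have A_x c : A (elem ord0 (lift ord0 ord0) c).
  case: c => p; first by rewrite -natz -elemX //; exact: AX.
  by rewrite NegzE elemN //; apply: AV; rewrite -natz -elemX //; exact: AX.
apply: companion_generation => //.
rewrite -[companion n'](mulgK (elem ord0 (lift ord0 ord0) (m + 21)%N%:Z)).
by apply: AM; [apply: A_S; rewrite /= !inE eqxx orbT | exact: AV].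
Qed.

(** * Vanishing of the infimum *)

Lemma kazhdan_le_ge0 (R : realType) (G : groupType) (d : nat) :
  (0 <= kazhdan_le R G d)%E.
Proof.
apply/ereal_infP => _ [S _ <-].
apply/ereal_infP => _ [H [pi [_ ->]]].
apply/ereal_infP => _ [u _ <-]; rewrite lee_fin /max_displacement.
elim/big_ind : _ => // [x y x0 y0|g _]; first by rewrite le_max x0.
by have := normr_ge0 (pi g u - u); rewrite lecE => /andP[].
Qed.

Theorem theorem1p1 (R : realType) (n : nat) (hn : (3 <= n)%N) :
  kazhdan_le R (SLZ n) 2 = 0%E.
Proof.
case: n hn => [|[|[|n']]] // _; apply/eqP; rewrite eq_le kazhdan_le_ge0 andbT.
apply/lee_addgt0Pr => e e0; rewrite add0e.
have [m me] : exists m : nat, 2 / Num.sqrt m.+1%:R <= e :> R.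
  exists (Num.bound ((2 / e) ^+ 2)).
  rewrite ler_pdivrMr ?sqrtr_gt0 ?ltr0n // mulrC -ler_pdivrMr //.
  rewrite -[leLHS]ger0_norm ?divr_ge0 ?(ltW e0) // -sqrtr_sqr ler_wsqrtr //.
  rewrite (le_trans (ltW (archi_boundP _))) ?sqr_ge0 // ler_nat.
  exact: leqnSn.
apply: ge_ereal_inf.
exists (kazhdan R [fset elem (ord0 : 'I_n'.+3) (lift ord0 ord0) 1;
    (companion n' * elem ord0 (lift ord0 ord0) (m + 21)%N%:Z)%g]%fset).
  eexists; last by [].
  by split; [exact: companion_generates | rewrite cardfs2; case: eqP].
apply: le_trans (SLZ_kazhdan_le n' m R) _.
by rewrite lee_fin.
Qed.
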